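(* As $n\to\infty$, $$g(n,K_3,S_4)=(1+o(1))\frac{n}{3},$$ where $S_4$ is the star with $4$ leaves.
   Context: Constructor-Blocker game: given graphs $H$ and $F$, two players, Constructor and Blocker, alternately claim previously unclaimed edges of the complete graph $K_n$, Constructor moving first. Constructor may only claim an edge if her graph (the edges she has claimed) remains $F$-free (contains no subgraph isomorphic to $F$); Blocker may claim any unclaimed edge. The game ends when Constructor cannot claim any more edges or all edges are claimed. The score is the number of copies of $H$ in Constructor's graph at the end. Constructor maximizes, Blocker minimizes; $g(n,H,F)$ denotes the score under optimal play by both. $S_k$ denotes the star with $k$ leaves (so being $S_k$-free means maximum degree at most $k-1$). *)

(* Defs.v *)
From mathcomp Require Import all_boot all_order all_algebra.
Set Implicit Arguments.
Unset Strict Implicit.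
Unset Printing Implicit Defensive.
Import Order.TTheory GRing.Theory Num.Theory.

(* Vertices of K_n are 'I_n; an edge is a 2-element subset of 'I_n;
   a (simple) graph on 'I_n is a set of edges. *)
Definition is_edge (n : nat) (e : {set 'I_n}) : bool := #|e| == 2.

Definition graph n := {set {set 'I_n}}.

Definition deg n (G : graph n) (v : 'I_n) : nat := #|[set e in G | v \in e]|.

(* S_k-free = maximum degree at most k-1 (as in the paper); S_4-free: max degree <= 3 *)
Definition star_free (k : nat) n (G : graph n) : bool :=
  [forall v : 'I_n, deg G v < k].

Definition triangles n (G : graph n) : nat :=
  #|[set T : {set 'I_n} | (#|T| == 3) &&
       [forall e : {set 'I_n}, ((e \subset T) && (#|e| == 2)) ==> (e \in G)]]|.

Definition maxseq (s : seq nat) : nat := foldr maxn 0 s.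
Definition minseq (s : seq nat) : nat :=
  match s with [::] => 0 | x :: s' => foldr minn x s' end.

Definition unclaimed n (C B : graph n) : seq {set 'I_n} :=
  [seq e <- enum [set: {set 'I_n}] | is_edge e && (e \notin C) && (e \notin B)].

Definition legal n (C B : graph n) : seq {set 'I_n} :=
  [seq e <- unclaimed C B | star_free 4 (e |: C)].

(* Minimax value of the Constructor-Blocker game g(n, K_3, S_4), from position
   (C, B) with Constructor to move iff [cturn]; [fuel] bounds the number of
   remaining moves (each move claims a new edge, so 'C(n,2) suffices).
   Constructor's turn: if she has no legal move the game ends with score
   triangles C; otherwise she maximises.  Blocker's turn: if no edge is
   unclaimed the game ends; otherwise he minimises. *)
Fixpoint game_val n (fuel : nat) (C B : graph n) (cturn : bool) : nat :=
  match fuel with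
  | 0 => triangles C
  | fuel'.+1 =>
    if cturn then
      match legal C B with
      | [::] => triangles C
      | l => maxseq [seq game_val fuel' (e |: C) B false | e <- l]
      end
    else
      match unclaimed C B with
      | [::] => triangles C
      | l => minseq [seq game_val fuel' C (e |: B) true | e <- l]
      end
  end.

Definition g_K3_S4 (n : nat) : nat :=
  game_val 'C(n, 2) (set0 : graph n) (set0 : graph n) true.

(* Main.v *)
Require Import Defs.
From mathcomp Require Import all_boot all_order all_algebra.
From mathcomp Require Import zify lra.
Set Implicit Arguments.
Unset Strict Implicit.
Unset Printing Implicit Defensive.

(** Upper bound: Blocker keeps Constructor's graph free of two triangles sharing
    an edge.  As the maximum degree is 3, the triangles are then vertex-disjoint
    and there are at most n/3 of them.  A vertex is harmless once at most one
    pair of its neighbours can become an edge; Blocker kills one pair when the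
    vertex reaches degree 2 and one when it reaches degree 3.  A single edge
    [p q] makes two such demands only if both ends reach degree 2; Blocker then
    serves [p], and the unserved [q] stays harmless because [p] has only one free
    slot left.

    Lower bound: Constructor keeps a reserve of constant size of vertices of
    degree at most 1.  In each round she joins a fresh vertex [c] to fresh
    vertices [x], [y] and then to a reserve vertex [z]; Blocker cannot claim both
    [x z] and [y z], so a triangle on [c], [z] and one of [x], [y] arises and the
    other one replaces [z] in the reserve.  A round uses 3 vertices, and only
    o(n) vertices can be spoiled by a large Blocker-degree. *)

(** * Values of the game *)

Section MinMax.
Implicit Type s : seq nat.

Lemma leq_maxseq s x : x \in s -> x <= maxseq s.
Proof.
elim: s => //= y s IHs; rewrite inE => /orP[/eqP->|/IHs]; rewrite leq_max ?leqnn //.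
by move=> ->; rewrite orbT.
Qed.

Lemma maxseq_leq s m : (forall x, x \in s -> x <= m) -> maxseq s <= m.
Proof.
elim: s => //= y s IHs les; rewrite geq_max les ?mem_head //=.
by apply: IHs => x xs; apply: les; rewrite inE xs orbT.
Qed.

Lemma minseq_leq s x : x \in s -> minseq s <= x.
Proof.
case: s => //= y s; elim: s => [|z s IHs] /=; first by rewrite mem_seq1 => /eqP->.
rewrite geq_min !inE => /or3P[xy|/eqP->|xs]; rewrite ?leqnn // IHs ?orbT //.
  by rewrite inE xy.
by rewrite inE xs orbT.
Qed.

Lemma leq_minseq s m : s != [::] -> (forall x, x \in s -> m <= x) -> m <= minseq s.
Proof.
case: s => //= y s _; elim: s => [|z s IHs] les /=; first by apply: les; rewrite mem_head.
rewrite leq_min les ?inE ?eqxx ?orbT //=; apply: IHs => x xs; apply: les.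
by move: xs; rewrite !inE => /orP[->|->]; rewrite ?orbT.
Qed.

End MinMax.

Section Game.
Variable n : nat.
Implicit Types (C B : graph n) (e f : {set 'I_n}).

Lemma mem_unclaimed C B e :
  (e \in unclaimed C B) = [&& is_edge e, e \notin C & e \notin B].
Proof. by rewrite mem_filter mem_enum inE andbT -andbA. Qed.

Lemma mem_legal C B e :
  (e \in legal C B) = star_free 4 (e |: C) && (e \in unclaimed C B).
Proof. by rewrite mem_filter. Qed.

Lemma game_val_legal0 fuel C B :
  legal C B = [::] -> game_val fuel C B true = triangles C.
Proof. by case: fuel => [|fuel] //= ->. Qed.

Lemma legal_unclaimed0 C B : unclaimed C B = [::] -> legal C B = [::].
Proof. by rewrite /legal => ->. Qed.

Lemma game_val_constructor fuel C B : legal C B != [::] ->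
  game_val fuel.+1 C B true =
  maxseq [seq game_val fuel (e |: C) B false | e <- legal C B].
Proof. by rewrite /=; case: (legal C B). Qed.

Lemma game_val_blocker fuel C B : unclaimed C B != [::] ->
  game_val fuel.+1 C B false =
  minseq [seq game_val fuel C (e |: B) true | e <- unclaimed C B].
Proof. by rewrite /=; case: (unclaimed C B). Qed.

Lemma game_val_unclaimed0 fuel C B :
  unclaimed C B = [::] -> game_val fuel C B false = triangles C.
Proof. by case: fuel => [|fuel] //= ->. Qed.

(* The case [B' = B] of the hypothesis covers the end of the game, when no
   edge is left to Blocker. *)
Lemma constructor_round fuel C B e m :
    e \in legal C B ->
    (forall B', B \subset B' ->
       (exists2 f, is_edge f & B' \subset f |: B) ->
       m <= game_val fuel (e |: C) B' true) ->
  m <= game_val fuel.+2 C B true.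
Proof.
move=> eL le_m; rewrite game_val_constructor; last by apply: contraTneq eL => L; rewrite L.
apply: leq_trans (leq_maxseq (map_f _ eL)).
have [U|U] := eqVneq (unclaimed (e |: C) B) [::].
  rewrite game_val_unclaimed0 // -(game_val_legal0 fuel (legal_unclaimed0 U)).
  apply: le_m => //; exists e; last exact: subsetUr.
  by move: eL; rewrite mem_legal mem_unclaimed => /and4P[].
rewrite game_val_blocker //; apply: leq_minseq => [|_ /mapP[f fU ->]].
  by case: (unclaimed _ _) U.
apply: le_m; first exact: subsetUr.
by exists f => //; move: fU; rewrite mem_unclaimed => /andP[].
Qed.

(** Monotonicity in [B] lets Blocker pass: he then claims any free edge. This also covers a
    prescribed reply [f] that he already owns. *)
Lemma blocker_strategy (P : graph n -> graph n -> Prop) m :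
    (forall C B, P C B -> triangles C <= m) ->
    (forall C B B', P C B -> B \subset B' -> P C B') ->
    (forall C B e, P C B -> e \in legal C B ->
       P (e |: C) B \/
       exists2 f, is_edge f && (f \notin e |: C) & P (e |: C) (f |: B)) ->
  forall fuel C B, P C B -> game_val fuel C B true <= m.
Proof.
move=> Ptri Pmono Pstep fuel C B; have [k] := ubnP fuel.
elim: k fuel C B => // k IHk [|fuel] C B ltk PCB; first exact: Ptri PCB.
have [L|L] := eqVneq (legal C B) [::]; first by rewrite game_val_legal0 // (Ptri _ _ PCB).
rewrite game_val_constructor //; apply: maxseq_leq => _ /mapP[e eL ->].
have [PB|[f fU Pf]] : P (e |: C) B \/
    exists2 f, f \in unclaimed (e |: C) B & P (e |: C) (f |: B).
  have [|[f /andP[fE fC] Pf]] := Pstep _ _ _ PCB eL; first by left.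
  have [fB|fB] := boolP (f \in B).
    by left; rewrite -(setUidPr (_ : [set f] \subset B)) ?sub1set.
  by right; exists f; rewrite // mem_unclaimed fE fC.
- case: fuel ltk => [|fuel] ltk; first exact: Ptri PB.
  case U: (unclaimed (e |: C) B) => [|f l].
    by rewrite game_val_unclaimed0 // (Ptri _ _ PB).
  have fU : f \in unclaimed (e |: C) B by rewrite U mem_head.
  rewrite game_val_blocker ?U // -U; apply: leq_trans (minseq_leq (map_f _ fU)) _.
  by apply: IHk; [lia | apply: Pmono PB _; apply: subsetUr].
case: fuel ltk => [|fuel] ltk; first exact: Ptri Pf.
rewrite game_val_blocker; last by apply: contraTneq fU => U; rewrite U.
by apply: leq_trans (minseq_leq (map_f _ fU)) _; apply: IHk => //; lia.
Qed.

End Game.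

(** * Blocker's invariant *)

Section Diamonds.
Variable V : finType.
Implicit Types (a b : rel V) (K : V -> V -> Prop) (p q r s t u v w x y z : V).

Definition ndeg a v := #|[set w | a v w]|.
Definition full a v := 2 < ndeg a v.
Definition add_edge a p q : rel V :=
  fun x y => [|| a x y, (x == p) && (y == q) | (x == q) && (y == p)].

(* In what follows [a] is Constructor's graph, [b] is Blocker's graph and [a'] is
   [a] plus the edge [p q] that Constructor has just claimed.  A pair is dead
   when it will never become an edge of Constructor. *)
Definition dead a b x y := ~~ a x y && [|| b x y, full a x | full a y].

(* The pair of neighbours of a debtor [v] is still open, but one of its ends [u]
   has degree two and its other neighbour can no longer be joined to [v]: any
   further edge at [u] either kills the pair or closes a triangle at [v] whose
   vertex [u] is full.  [K v u] records that [u] secures [v]; a vertex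
   secures at most one debtor. *)
Definition secured K a b v u :=
  [/\ K v u, ndeg a u = 2 & forall z, a u z -> z != v -> dead a b v z].

(** In the second option the pair already closes a triangle at [v]. If [v] later gains a third
    neighbour, the full end admits no new edge, which leaves at most one open pair. *)
Definition safe2 K a b v := forall x y, x != y -> a v x -> a v y ->
  [\/ dead a b x y, a x y && (full a x || full a y), secured K a b v x
    | secured K a b v y].

(** If a stuck [y] of degree two is joined to the vertex [t] of [safe3], the pair formed by [t] and
    the other neighbour of [y] dies at once because that neighbour is full. Blocker's reply can then
    be spent at [v]. *)
Definition stuck a v y :=
  full a y \/ ndeg a y = 2 /\ forall w, a y w -> w != v -> full a w.

(* At most one of the three pairs of neighbours of the full vertex [v] can become
   an edge: either two of them are dead, or the pair missing [t] is dead and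
   joining [t] to one neighbour of [v] lets Blocker kill the remaining pair (it
   dies by itself when [t] has degree two). *)
Definition safe3 a b v := exists t, [/\ a v t,
    forall y z, a v y -> a v z -> y != z -> y != t -> z != t -> dead a b y z
  & (exists2 y, a v y && (y != t) & dead a b t y) \/
    (forall y, a v y -> ~~ a t y) /\
    (1 < ndeg a t \/ forall y, a v y -> y != t -> stuck a v y)].

Definition safe K a b v :=
  (ndeg a v = 2 -> safe2 K a b v) /\ (ndeg a v = 3 -> safe3 a b v).

(** The bound comes from [inv_c4]: two triangles sharing the edge [x y] would make [x y] the
    diagonal of a 4-cycle, yet an edge is never dead. *)
Record blocker_inv K a b : Prop := BlockerInv {
  inv_sym : symmetric a;
  inv_irr : irreflexive a;
  inv_blk : symmetric b;
  inv_deg : forall v, ndeg a v <= 3;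
  inv_inj : forall u v w, K v u -> K w u -> v = w;
  inv_safe : forall v, safe K a b v;
  inv_c4 : forall x y r s, x != y -> r != s ->
    a x r -> a x s -> a y r -> a y s -> dead a b x y }.

Record cmove a b a' p q : Prop := Move {
  move_neq : p != q;
  move_a : ~~ a p q;
  move_b : ~~ b p q;
  move_p : ndeg a p <= 2;
  move_q : ndeg a q <= 2;
  move_E : forall x y, a' x y = add_edge a p q x y }.

Lemma dead_sym a b x y : symmetric a -> symmetric b -> dead a b x y = dead a b y x.
Proof. by move=> sa sb; rewrite /dead sa sb [full a x || _]orbC. Qed.

Lemma live_ndeg a b x y : ~~ dead a b x y -> ~~ a x y -> ndeg a x <= 2 /\ ndeg a y <= 2.
Proof. by rewrite /dead /full => /[swap]-> /=; rewrite !negb_or -!leqNgt => /and3P[]. Qed.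

Lemma full_ndeg a v : full a v -> ndeg a v <= 3 -> ndeg a v = 3.
Proof. by move=> fv dv; apply/eqP; rewrite eqn_leq dv. Qed.

Lemma nat_2or3 d : 1 < d -> d <= 3 -> d = 2 \/ d = 3.
Proof. by case: d => [|[|[|[|d]]]] // _ _; [left|right]. Qed.

Lemma ndeg_gt0 a v x : a v x -> 0 < ndeg a v.
Proof. by move=> avx; apply/card_gt0P; exists x; rewrite inE. Qed.

Lemma ndeg1_eq a v x w : ndeg a v <= 1 -> a v x -> a v w -> w = x.
Proof.
move=> dv ax aw; apply/eqP; have := card_le1_eqP dv; move/(_ w x).
by rewrite !inE => /(_ aw ax) ->.
Qed.

Lemma ndeg_gt1 a v x y : x != y -> a v x -> a v y -> 1 < ndeg a v.
Proof.
move=> nxy ax ay; rewrite -(_ : #|[set x; y]| = 2); last by rewrite cards2 nxy.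
by apply/subset_leq_card/subsetP => w; rewrite !inE => /orP[]/eqP->.
Qed.

Lemma ndeg_gt2 a v x y z :
  x != y -> x != z -> y != z -> a v x -> a v y -> a v z -> full a v.
Proof.
move=> nxy nxz nyz ax ay az; rewrite /full /ndeg (cardsD1 x) (cardsD1 y) (cardsD1 z).
by rewrite !inE ax ay az (eq_sym y) nxy !(eq_sym z) nxz nyz.
Qed.

Lemma ndeg2_mem a v x y w :
  ndeg a v <= 2 -> x != y -> a v x -> a v y -> a v w -> w = x \/ w = y.
Proof.
move=> dv nxy ax ay aw; have [->|nwx] := eqVneq w x; first by left.
have [->|nwy] := eqVneq w y; first by right.
by have := ndeg_gt2 nxy _ _ ax ay aw; rewrite /full !(eq_sym _ w) => /(_ nwx nwy); lia.
Qed.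

Lemma ndeg2_other a v x : ndeg a v = 2 -> a v x -> exists2 y, y != x & a v y.
Proof.
rewrite /ndeg => dv ax; have: 0 < #|[set w | a v w] :\ x|.
  by move: dv; rewrite (cardsD1 x) inE ax; lia.
by case/card_gt0P=> y; rewrite !inE => /andP[]; exists y.
Qed.

Lemma ndeg3_other a v x y :
  ndeg a v = 3 -> x != y -> a v x -> a v y -> exists z, [/\ z != x, z != y & a v z].
Proof.
rewrite /ndeg => dv nxy ax ay; have: 0 < #|[set w | a v w] :\ x :\ y|.
  move: dv; rewrite (cardsD1 x) inE ax (cardsD1 y) !inE eq_sym nxy ay /=; lia.
by case/card_gt0P=> z; rewrite !inE => /and3P[? ? ?]; exists z.
Qed.

Lemma ndeg3_mem a v x y z w : ndeg a v <= 3 -> x != y -> x != z -> y != z ->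
  a v x -> a v y -> a v z -> a v w -> [\/ w = x, w = y | w = z].
Proof.
move=> dv nxy nxz nyz ax ay az aw.
have [->|nwx] := eqVneq w x; first by constructor 1.
have [->|nwy] := eqVneq w y; first by constructor 2.
have [->|nwz] := eqVneq w z; first by constructor 3.
move: dv; rewrite /ndeg (cardsD1 x) (cardsD1 y) (cardsD1 z) (cardsD1 w).
by rewrite !inE ax ay az aw nwx nwy nwz (eq_sym y) nxy !(eq_sym z) nxz nyz.
Qed.

Lemma safe3_two a b v x y z : symmetric a -> symmetric b -> ndeg a v <= 3 ->
    x != y -> x != z -> y != z -> a v x -> a v y -> a v z ->
    dead a b x y -> dead a b x z ->
  safe3 a b v.
Proof.
move=> sa sb dv nxy nxz nyz ax ay az dxy dxz; exists y; split=> //; last first.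
  by left; exists x; rewrite ?ax // dead_sym.
have mem w := @ndeg3_mem a v x y z w dv nxy nxz nyz ax ay az.
move=> s t /mem[]-> /mem[]->; rewrite ?eqxx // => *.
by rewrite dead_sym.
Qed.

(** An edge is never dead, so [x y] must be the one exception that [safe3] leaves open. Its second
    option has no edge between neighbours of [v]. *)
Lemma safe3_adj a b v x y z : symmetric a -> symmetric b -> ndeg a v <= 3 ->
    x != y -> x != z -> y != z -> a v x -> a v y -> a v z ->
    a x y -> safe3 a b v ->
  dead a b x z /\ dead a b y z.
Proof.
move=> sa sb dv nxy nxz nyz ax ay az axy [t [at_ dth opt]].
have mem w := @ndeg3_mem a v x y z w dv nxy nxz nyz ax ay az.
have [] := mem t at_ => Et; subst t.
- have dyz : dead a b y z by apply: dth; rewrite // eq_sym.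
  split=> //; case: opt => [[w /andP[/mem[]-> nw] dw]|[/(_ y ay)]].
  + by rewrite eqxx in nw.
  + by move: dw; rewrite /dead axy.
  + by [].
  by rewrite axy.
- have dxz : dead a b x z by apply: dth; rewrite // eq_sym.
  split=> //; case: opt => [[w /andP[/mem[]-> nw] dw]|[/(_ x ax)]].
  + by move: dw; rewrite /dead sa axy.
  + by rewrite eqxx in nw.
  + by [].
  by rewrite sa axy.
by have: dead a b x y by [apply: dth]; rewrite /dead axy.
Qed.

Lemma safe2_dead K a b v x y : symmetric a -> symmetric b ->
  (forall w, a v w -> w = x \/ w = y) -> dead a b x y -> safe2 K a b v.
Proof.
move=> sa sb mem d s t nst /mem[]Es /mem[]Et; subst s t; rewrite ?eqxx // in nst *.
  by constructor 1.
by constructor 1; rewrite dead_sym.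
Qed.

Lemma safe2_triangle K a b v x y : symmetric a ->
  (forall w, a v w -> w = x \/ w = y) -> a x y -> full a x -> safe2 K a b v.
Proof.
move=> sa mem axy fx s t nst /mem[]Es /mem[]Et; subst s t; rewrite ?eqxx // in nst *.
  by constructor 2; rewrite axy fx.
by constructor 2; rewrite sa axy fx orbT.
Qed.

Lemma add_edge_sym b x y : symmetric b -> symmetric (add_edge b x y).
Proof.
by move=> sb u v; rewrite /add_edge sb; congr (_ || _); rewrite orbC ![(_ == x) && _]andbC.
Qed.

Lemma move_sym a b a' p q : symmetric a -> symmetric b ->
  cmove a b a' p q -> cmove a b a' q p.
Proof.
move=> sa sb [npq apq bpq dp dq E].
split=> //; rewrite 1?eq_sym // 1?sa 1?sb // => x y.
by rewrite E /add_edge; congr (_ || _); rewrite orbC.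
Qed.

(** * Effect of one Constructor edge on degrees, dead pairs and the invariant *)

Section Move.
Variables (K : V -> V -> Prop) (a b a' : rel V) (p q : V).
Hypotheses (I : blocker_inv K a b) (M : cmove a b a' p q).

Lemma add_sym : symmetric a'.
Proof.
move=> x y; rewrite !(move_E M) /add_edge (inv_sym I); congr (_ || _).
by rewrite orbC ![(_ == p) && _]andbC.
Qed.

Lemma add_irr : irreflexive a'.
Proof.
move=> x; rewrite (move_E M) /add_edge (inv_irr I) /=.
by have [->|] := eqVneq x p; rewrite ?(negPf (move_neq M)) ?andbF.
Qed.

Lemma add_sub x y : a x y -> a' x y.
Proof. by rewrite (move_E M) /add_edge => ->. Qed.

Lemma add_off v w : v != p -> v != q -> a' v w = a v w.
Proof. by move=> /negPf np /negPf nq; rewrite (move_E M) /add_edge np nq !orbF. Qed.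

Lemma add_p w : a' p w = a p w || (w == q).
Proof. by rewrite (move_E M) /add_edge eqxx (negPf (move_neq M)) orbF. Qed.

Lemma ndeg_off v : v != p -> v != q -> ndeg a' v = ndeg a v.
Proof. by move=> np nq; apply: eq_card => w; rewrite !inE add_off. Qed.

Lemma ndeg_p : ndeg a' p = (ndeg a p).+1.
Proof.
rewrite /ndeg (_ : [set w | a' p w] = q |: [set w | a p w]).
  by rewrite cardsU1 inE (negPf (move_a M)).
by apply/setP=> w; rewrite !inE add_p orbC.
Qed.

End Move.

Section Step.
Variables (K : V -> V -> Prop) (a b a' : rel V) (p q : V).
Hypotheses (I : blocker_inv K a b) (M : cmove a b a' p q).

Let sa := inv_sym I.
Let sb := inv_blk I.
Let M' : cmove a b a' q p := move_sym sa sb M.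
Let sa' := add_sym I M.

Lemma full_add v : full a v -> full a' v.
Proof.
move=> fv; rewrite /full (ndeg_off M) //; apply: contraTneq fv => ->.
  by have := move_p M; rewrite /full; lia.
by have := move_q M; rewrite /full; lia.
Qed.

Lemma move_live : ~~ dead a b p q.
Proof.
rewrite /dead (negPf (move_a M)) (negPf (move_b M)) /full /=.
by have := move_p M; have := move_q M; lia.
Qed.

(** Death is permanent: full vertices stay full, and the claimed pair [p q] was live, so no dead
    pair becomes an edge. *)
Lemma dead_add b' x y : subrel b b' -> dead a b x y -> dead a' b' x y.
Proof.
move=> sbb' dxy; have := move_live; move: dxy; rewrite /dead => /andP[naxy H] L.
rewrite (move_E M) /add_edge (negPf naxy) /=; apply/andP; split.
  apply: contra L => /orP[]/andP[/eqP<- /eqP<-]; first by rewrite naxy.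
  by rewrite sa naxy sb /= [full a y || _]orbC.
by case/or3P: H => [/sbb'->|/full_add->|/full_add->]; rewrite ?orbT.
Qed.

Lemma ndeg_add v : ndeg a v <= ndeg a' v.
Proof. by apply/subset_leq_card/subsetP=> w; rewrite !inE; apply: (add_sub M). Qed.

Lemma full_end v : ndeg a v = 2 -> (v == p) || (v == q) -> full a' v.
Proof.
by move=> dv /orP[]/eqP Ev; subst v; rewrite /full ?(ndeg_p M) ?(ndeg_p M') dv.
Qed.

Lemma full_dead b' x y : full a' x -> ~~ a' x y -> dead a' b' x y.
Proof. by rewrite /dead => -> ->; rewrite orbT. Qed.

Lemma stuck_add v y : v != p -> v != q -> stuck a v y -> stuck a' v y.
Proof.
move=> np nq [/full_add|[dy fw]]; first by left.
have [yE|] := boolP ((y == p) || (y == q)); first by left; apply: full_end.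
rewrite negb_or => /andP[yp yq]; right; rewrite (ndeg_off M) //; split=> // w.
by rewrite (add_off M) // => ayw /(fw _ ayw)/full_add.
Qed.

Lemma secured_add K' b' v u : subrel b b' ->
    (forall x y, K x y -> ndeg a y = 2 -> K' x y) ->
    u != p -> u != q -> secured K a b v u ->
  secured K' a' b' v u.
Proof.
move=> sbb' sKK' np nq [Kvu du dth]; split; first exact: sKK'.
  by rewrite (ndeg_off M).
by move=> z; rewrite (add_off M) // => auz nz; apply: dead_add (dth _ auz nz).
Qed.

(** Away from [p] and [q] the edge changes little: it remains to check the two ends, the full
    vertices adjacent to both, and the 4-cycles through [p q]. [K'] may differ from [K] only where
    the securing vertex did not have degree two or where new pairs are added. *)
Lemma invariant_add K' b' : subrel b b' -> symmetric b' ->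
    (forall x y, K x y -> ndeg a y = 2 -> K' x y) ->
    (forall u v w, K' v u -> K' w u -> v = w) ->
    safe K' a' b' p -> safe K' a' b' q ->
    (forall v, ndeg a v = 3 -> a v p -> a v q -> safe3 a' b' v) ->
    (forall r y, a p r -> a r y -> a y q -> dead a' b' p y /\ dead a' b' r q) ->
  blocker_inv K' a' b'.
Proof.
move=> sbb' sb' sKK' injK' Sp Sq S3 S4; have irr' := add_irr I M; split=> //.
- move=> v; have [->|np] := eqVneq v p.
    by rewrite (ndeg_p M); have := move_p M; lia.
  have [->|nq] := eqVneq v q; last by rewrite (ndeg_off M) // (inv_deg I).
  by rewrite (ndeg_p M'); have := move_q M; lia.
- move=> v; have [->//|np] := eqVneq v p; have [->//|nq] := eqVneq v q.
  have [S2 S3v] := inv_safe I v; split; rewrite (ndeg_off M) // => dv.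
    move=> x y nxy; rewrite !(add_off M _ np nq) => avx avy.
    (* An end [u] of the new edge had degree two and becomes full, so its pair is now dead or is an
       edge with a full end. *)
    have sec u z : secured K a b v u ->
        [\/ dead a' b' u z, a' u z && full a' u | secured K' a' b' v u].
      move=> sec; have [uE|] := boolP ((u == p) || (u == q)).
        have fu : full a' u by apply: full_end uE; case: sec.
        have [auz|nauz] := boolP (a' u z); first by constructor 2.
        by constructor 1; apply: full_dead.
      by rewrite negb_or => /andP[up uq]; constructor 3; apply: secured_add sec.
    have [d|/andP[axy f]|/(sec _ y)[d|/andP[axy f]|]|/(sec _ x)[d|/andP[axy f]|]] :=
      S2 dv x y nxy avx avy.
    + by constructor 1; apply: dead_add d.
    + constructor 2; rewrite (add_sub M) //.
      by case/orP: f => /full_add->; rewrite ?orbT.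
    + by constructor 1.
    + by constructor 2; rewrite axy f.
    + by constructor 3.
    + by constructor 1; rewrite dead_sym.
    + by constructor 2; rewrite sa' axy f orbT.
    + by constructor 4.
  have [/andP[avp avq]|nvpq] := boolP (a v p && a v q); first exact: S3.
  have [t [avt dth opt]] := S3v dv; exists t; split; rewrite ?(add_off M _ np nq) //.
    by move=> y z; rewrite !(add_off M _ np nq) => avy avz nyz nyt nzt;
       apply: dead_add (dth _ _ avy avz nyz nyt nzt).
  case: opt => [[y /andP[avy nyt] dty]|[nadj opt]].
    by left; exists y; rewrite ?(add_off M _ np nq) ?avy //; apply: dead_add dty.
  right; split.
    move=> y; rewrite (add_off M _ np nq) => avy; rewrite (move_E M) /add_edge.
    rewrite (negPf (nadj _ avy)) /=; apply: contra nvpq.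
    by case/orP=> /andP[/eqP<- /eqP<-]; rewrite avt avy.
  case: opt => [dt|st]; [left; exact: leq_trans dt (ndeg_add t) | right => y].
  by rewrite (add_off M _ np nq) => avy /(st _ avy); apply: stuck_add.
have addE x y : a' x y -> a x y \/ x = p /\ y = q \/ x = q /\ y = p.
  rewrite (move_E M) => /or3P[->|/andP[/eqP-> /eqP->]|/andP[/eqP-> /eqP->]].
  - by left.
  - by right; left.
  - by right; right.
(* If the side [x r] is the new edge, the other three sides form a path from [p] to [q], to which
   [S4] applies. *)
have half x y r s : x != y -> r != s -> a' x r -> a' x s -> a' y r -> a' y s ->
    ~~ a x r -> dead a' b' x y.
  move=> nxy nrs xr xs yr ys naxr.
  have [axr|[[Ex Er]|[Ex Er]]] := addE _ _ xr; first by rewrite axr in naxr.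
    subst x r; have ny : y != q by apply: contraTneq yr => ->; rewrite irr'.
    apply: proj1 (S4 s y _ _ _).
    + by move: xs; rewrite (add_p M) eq_sym (negPf nrs) orbF.
    + by move: ys; rewrite sa (add_off M) // eq_sym.
    + by move: yr; rewrite (add_off M) // eq_sym.
  subst x r; have ny : y != p by apply: contraTneq yr => ->; rewrite irr'.
  rewrite dead_sym //; apply: proj2 (S4 y s _ _ _).
  + by move: yr; rewrite sa (add_off M) // eq_sym.
  + by move: ys; rewrite (add_off M) // eq_sym.
  + by move: xs; rewrite (add_p M') eq_sym (negPf nrs) orbF sa.
move=> x y r s nxy nrs xr xs yr ys.
have [axr|] := boolP (a x r); last exact: half xr xs yr ys.
have [axs|] := boolP (a x s); last by apply: half xs xr ys yr; rewrite // eq_sym.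
have [ayr|] := boolP (a y r); last first.
  by rewrite dead_sym //; apply: half yr ys xr xs; rewrite // eq_sym.
have [ays|] := boolP (a y s); last first.
  by rewrite dead_sym //; apply: half ys yr xs xr; rewrite // eq_sym.
exact: dead_add (inv_c4 I nxy nrs axr axs ayr ays).
Qed.

(** * Blocker's replies, starting with the 4-cycles closed by the move *)

Definition answered := (exists K', blocker_inv K' a' b) \/
  exists x y, [/\ x != y, ~~ a' x y & exists K', blocker_inv K' a' (add_edge b x y)].

(** A reply matters only through the death of [x y]; quantifying over [b'] hides the rest. *)
Lemma answered_block x y : x != y -> ~~ a' x y ->
    (forall b', subrel b b' -> symmetric b' -> dead a' b' x y ->
       exists K', blocker_inv K' a' b') ->
  answered.
Proof.
move=> nxy naxy H; right; exists x, y; split=> //; apply: H.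
- by move=> u v buv; rewrite /add_edge buv.
- exact: add_edge_sym.
by rewrite /dead naxy /add_edge !eqxx orbT.
Qed.

Lemma dead_sub b' x y : subrel b b' -> dead a' b x y -> dead a' b' x y.
Proof. by rewrite /dead => sbb' /andP[-> /orP[/sbb'->|->]]; rewrite ?orbT. Qed.

Lemma adj_neq x y : a x y -> x != y.
Proof. by apply: contraTneq => ->; rewrite (inv_irr I). Qed.

Lemma nadj_neq x y : a p x -> a y q -> (x != q) * (y != p).
Proof.
move=> px yq; split; apply: contraTneq (move_a M) => E; subst; first by rewrite px.
by rewrite yq.
Qed.

(** Two common neighbours would make [p q] a diagonal of a 4-cycle, hence dead before it was
    claimed. *)
Lemma common_nbr_uniq r v : a p r -> a r q -> a p v -> a v q -> v = r.
Proof.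
move=> pr rq pv vq; apply/eqP; apply: contraNT move_live; rewrite eq_sym => nrv.
by apply: (inv_c4 I (move_neq M) nrv); rewrite // 1?sa.
Qed.

(** A live [p y] after the move forces [p] and [y] to have low degree. The safety of [r] then
    settles [r q]: if [r] has degree two, [p] has too small a degree to secure it, so [y] does and
    this kills [r q]; otherwise [r] is full. *)
Lemma c4_dead r y : a p r -> a r y -> a y q -> ~~ dead a' b p y ->
  [/\ ndeg a p = 1, ndeg a y = 2, ~~ a' p y, dead a' b r q
    & secured K a b r y \/ ndeg a r = 3].
Proof.
move=> pr ry yq live; have [rq yp] := nadj_neq pr yq.
have rp : r != p by rewrite eq_sym adj_neq.
have ryn := adj_neq ry; have yqn := adj_neq yq; have pq := move_neq M.
(* A chord [p y] would make [y] full with the edge [p r] among its neighbours, and [safe3_adj] would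
   kill [p q]. *)
have napy : ~~ a p y.
  apply: contra move_live => py.
  have fy : full a y by apply: (@ndeg_gt2 _ y p r q); rewrite // 1?eq_sym // 1?sa.
  have [_ s3] := inv_safe I y; have dy := inv_deg I y.
  have {}s3 : safe3 a b y by apply: s3; apply: full_ndeg.
  by apply: (proj1 (safe3_adj sa sb dy _ _ _ _ _ _ pr s3)); rewrite // 1?eq_sym // 1?sa.
have na'py : ~~ a' p y by rewrite (add_p M) (negPf napy).
have dp : ndeg a p = 1.
  have [] := live_ndeg live na'py; rewrite (ndeg_p M) ltnS => dp _.
  by apply/eqP; rewrite eqn_leq dp (ndeg_gt0 pr).
have dy : ndeg a y = 2.
  have [_] := live_ndeg live na'py; rewrite (ndeg_off M yp yqn) => dy.
  by apply/eqP; rewrite eqn_leq dy; apply: (@ndeg_gt1 _ y r q); rewrite // 1?sa.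
have live0 : ~~ dead a b p y by apply: contra live; apply: dead_add.
have dr1 : 1 < ndeg a r by apply: (@ndeg_gt1 _ r p y); rewrite // 1?eq_sym // 1?sa.
have dr3 := inv_deg I r; have [s2 s3] := inv_safe I r.
have rp' : a r p by rewrite sa.
have [dr|dr] := nat_2or3 dr1 dr3.
  have npy : p != y by rewrite eq_sym.
  have [d|/andP[py _]|[_ dp2 _]|sec] := s2 dr p y npy rp' ry.
  - by rewrite d in live0.
  - by rewrite py in napy.
  - by rewrite dp in dp2.
  have drq : dead a b r q by case: sec => _ _; apply; rewrite // eq_sym.
  by split=> //; [apply: dead_add drq | left].
split=> //; last by right.
apply: full_dead; first by apply: full_add; rewrite /full dr.
rewrite (add_off M) //; apply: contra live0 => arq.
have := safe3_adj sa sb dr3 yqn yp _ ry arq rp' yq (s3 dr).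
by rewrite eq_sym pq => /(_ isT)[+ _]; rewrite dead_sym.
Qed.

(** Blocker kills [p y]. The other diagonal [r q] is dead already, which makes [p] safe. If [q]
    becomes full, the dead pair [p y] is complemented by what the earlier safety of [q] provides. *)
Lemma answered_c4 r y :
  a p r -> a r y -> a y q -> ~~ dead a' b p y -> answered.
Proof.
move=> pr ry yq live; have [dp dy napy drq opt] := c4_dead pr ry yq live.
have [rq yp] := nadj_neq pr yq; have pq := move_neq M.
have rp : r != p by rewrite eq_sym adj_neq.
have ryn := adj_neq ry; have yqn := adj_neq yq.
have pE w : a p w -> w = r by apply: ndeg1_eq; rewrite ?dp.
have narq : ~~ a r q.
  by apply: contraL drq => arq; rewrite /dead (add_sub M).
have yE w : a y w -> w = r \/ w = q.
  by apply: ndeg2_mem; rewrite ?dy // 1?sa.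
apply: (answered_block (x := p) (y := y)) => //; first by rewrite eq_sym.
move=> b' sbb' sb' dpy; exists K; have drq' := dead_sub sbb' drq.
have dyp : dead a' b' y p by rewrite dead_sym.
apply: (invariant_add sbb' sb') => //; first exact: inv_inj I.
- split; rewrite (ndeg_p M) dp // => _; apply: safe2_dead drq' => //.
  by move=> w; rewrite (add_p M) => /orP[/pE|/eqP]; [left|right].
- have qy : a q y by rewrite sa.
  split; rewrite (ndeg_p M') => -[dq].
    apply: safe2_dead dyp => // w; rewrite (add_p M') => /orP[|/eqP]; last by right.
    by move/(ndeg1_eq (eq_leq dq) qy); left.
  have [z nzy qz] := ndeg2_other dq qy.
  have zp : z != p by apply: contraTneq qz => ->; rewrite sa (move_a M).
  have zr : z != r by apply: contraTneq qz => ->; rewrite sa.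
  have zq : z != q by rewrite eq_sym adj_neq.
  have nyz : y != z by rewrite eq_sym.
  have dq' : ndeg a' q <= 3 by rewrite (ndeg_p M') dq.
  have qy' := add_sub M qy; have qz' := add_sub M qz.
  have qp' : a' q p by rewrite (add_p M') eqxx orbT.
  have mem w := @ndeg3_mem a' q p y z w dq'.
  have {}mem w : a' q w -> [\/ w = p, w = y | w = z] by apply: mem; rewrite // eq_sym.
  have nazy : ~~ a z y.
    by rewrite sa; apply/negP=> /yE[]E; rewrite E eqxx in zr zq.
  have shared : (1 < ndeg a' z \/ stuck a' q p /\ stuck a' q y) -> safe3 a' b' q.
    move=> ex; exists z; split=> //.
      by move=> s t /mem[]-> /mem[]->; rewrite ?eqxx.
    right; split.
      move=> w /mem[]->.
      - rewrite sa' (add_p M) (negPf zq) orbF.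
        by apply/negP=> /pE E; rewrite E eqxx in zr.
      - by rewrite (add_off M).
      - by rewrite (add_irr I M).
    case: ex => [|[sp sy]]; [by left|right].
    by move=> w /mem[]->; rewrite ?eqxx.
  have [s2 _] := inv_safe I q.
  have [d|/andP[ayz _]|[Kqy _ _]|[_ dz _]] := s2 dq y z nyz qy qz.
  - apply: (safe3_two (x := y) (y := p) (z := z)); rewrite // 1?eq_sym //.
    exact: dead_add d.
  - by rewrite sa ayz in nazy.
  (* If [y] secures [q], it cannot also secure [r], so [r] is full. Both [p] and [y] have [r] as
     their only neighbour besides [q], hence they are stuck. *)
  - case: opt => [[Kry _ _]|dr].
      by move: rq; rewrite (inv_inj I Kry Kqy) eqxx.
    have fr : full a' r by apply: full_add; rewrite /full dr.
    apply: shared; right; split; right.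
      rewrite (ndeg_p M) dp; split=> // w; rewrite (add_p M).
      by case/orP=> [/pE->|->].
    rewrite (ndeg_off M) //; split=> // w; rewrite (add_off M) //.
    by case/yE=> ->; rewrite ?eqxx.
  by apply: shared; left; apply: leq_trans (ndeg_add z); rewrite dz.
- move=> v _; rewrite [a v p]sa => /pE-> arq; by rewrite arq in narq.
(* A second live diagonal [p y2] would give [r] the neighbours [p], [y], [y2]. Then [safe3] at [r]
   forces [t = p]; but [p] has degree one, and [y] is not stuck because its neighbour [q] is not
   full. *)
move=> r2 y2 /pE-> ry2 y2q; split=> //.
have [->//|nyy2] := eqVneq y2 y.
apply: contraT => live2'.
have live2 : ~~ dead a' b p y2 by apply: contra live2'; apply: dead_sub.
have [_ dy2 _ _ _] := c4_dead pr ry2 y2q live2.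
have [_ y2p] := nadj_neq pr y2q; have rp' : a r p by rewrite sa.
have [py py2] : p != y /\ p != y2 by rewrite ![p == _]eq_sym.
have yy2 : y != y2 by rewrite eq_sym.
have dr : ndeg a r = 3.
  by apply: full_ndeg (inv_deg I r); apply: ndeg_gt2 py py2 yy2 rp' ry ry2.
have mem w := ndeg3_mem (eq_leq dr) py py2 yy2 rp' ry ry2 (w := w).
have L w : dead a b p w -> w <> y /\ w <> y2.
  move=> d; split=> E; subst w.
    by move: live; rewrite (dead_add (b' := b)).
  by move: live2; rewrite (dead_add (b' := b)).
have [t [rt dth o]] := (inv_safe I r).2 dr.
have [] := mem t rt => E; subst t.
- case: o => [[w /andP[/mem[]-> nw] /L[]//]|[_ [|]]].
  + by rewrite eqxx in nw.
  + by rewrite dp.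
  case/(_ y ry yp) => [|[_ /(_ q yq)]]; first by rewrite /full dy.
  by rewrite eq_sym => /(_ rq); rewrite /full ltnNge (move_q M).
- have [] // := L y2; apply: dth; rewrite // eq_sym //.
have [] // := L y; apply: dth => //.
Qed.

(** The triangle [r p q] has the full vertex [r]. If [p] also has a third neighbour [x], then [r x]
    dies because [r] is full, and [x q] is dead by assumption. *)
Lemma triangle3_safe b' r s : symmetric b' ->
    ndeg a r = 3 -> a r p -> a r q -> a r s -> s != p -> s != q ->
    dead a' b' p s -> (forall x, x != r -> a p x -> dead a' b' x q) ->
  safe K a' b' p.
Proof.
move=> sb' dr rp rq rs sp sq dps dxq; have pq := move_neq M.
have pr : a p r by rewrite sa.
have [rnp rnq] := (adj_neq rp, adj_neq rq).
have fr : full a' r by apply: full_add; rewrite /full dr.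
have pq' : a' p q by rewrite (add_p M) eqxx orbT.
split; rewrite (ndeg_p M) => -[dp].
  apply: (@safe2_triangle K a' b' p r q) => //; last exact: (add_sub M).
  move=> w; rewrite (add_p M) => /orP[|/eqP]; last by right.
  by move/(ndeg1_eq (eq_leq dp) pr); left.
have [x nxr px] := ndeg2_other dp pr.
have xq : x != q by apply: contraTneq px => ->; apply: move_a M.
apply: (safe3_two (x := x) (y := r) (z := q)); rewrite ?(ndeg_p M) ?dp //.
- exact: (add_sub M).
- exact: (add_sub M).
- rewrite dead_sym //; apply: full_dead => //; rewrite (add_off M) //.
  have nsp : p != s by rewrite eq_sym.
  have nsq : q != s by rewrite eq_sym.
  apply/negP=> /(ndeg3_mem (eq_leq dr) pq nsp nsq rp rq rs)[]E; subst x.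
  + by rewrite (inv_irr I) in px.
  + by rewrite eqxx in xq.
  + by move: dps; rewrite /dead (add_sub M).
exact: dxq.
Qed.

(** * Moves whose new 4-cycles already have dead diagonals *)

Hypothesis c4ok :
  forall r y, a p r -> a r y -> a y q -> dead a' b p y /\ dead a' b r q.

Lemma invariant_add_nil b' : subrel b b' -> symmetric b' ->
    safe K a' b' p -> safe K a' b' q ->
    (forall v, ndeg a v = 3 -> a v p -> a v q -> safe3 a' b' v) ->
  blocker_inv K a' b'.
Proof.
move=> sbb' sb' Sp Sq S3; apply: (invariant_add sbb' sb') => //; first exact: inv_inj I.
by move=> r y pr ry yq; have [] := c4ok pr ry yq; split; apply: dead_sub.
Qed.

(** Since [p] secured [r], its other neighbour [x] has [r x] dead. If [q] stays below degree three,
    Blocker kills [x q]. Otherwise [q] is full, [x q] dies by itself, and Blocker serves [q] by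
    killing [r y]. *)
Lemma answered_triangle2 r :
  ndeg a r = 2 -> a r p -> a r q -> secured K a b r p -> answered.
Proof.
move=> dr rp rq [_ dp dth]; have pq := move_neq M.
have pr : a p r by rewrite sa.
have [x nxr px] := ndeg2_other dp pr.
have drx : dead a b r x by apply: dth.
have xq : x != q by apply: contraTneq px => ->; apply: move_a M.
have [rnp rnq] := (adj_neq rp, adj_neq rq).
have naxq : ~~ a x q.
  by apply: contra nxr => axq; rewrite (common_nbr_uniq pr rq px axq).
have xp : x != p by rewrite eq_sym adj_neq.
have fp : full a' p by rewrite /full (ndeg_p M) dp.
have pq' : a' p q by rewrite (add_p M) eqxx orbT.
have Sp b' : subrel b b' -> symmetric b' -> dead a' b' x q -> safe K a' b' p.
  move=> sbb' sb' dxq; split; rewrite (ndeg_p M) dp // => _.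
  apply: (safe3_two (x := x) (y := r) (z := q)); rewrite ?(ndeg_p M) ?dp //.
  - exact: (add_sub M).
  - exact: (add_sub M).
  - by rewrite dead_sym //; apply: dead_add drx.
have S3 b' v : ndeg a v = 3 -> a v p -> a v q -> safe3 a' b' v.
  by rewrite [a v p]sa => dv pv vq; move: dv; rewrite (common_nbr_uniq pr rq pv vq) dr.
have [dq|dq] : ndeg a q <= 1 \/ ndeg a q = 2.
  by have := move_q M; rewrite leq_eqVlt => /orP[/eqP|]; [right|left].
  apply: (answered_block (x := x) (y := q)); rewrite // ?(add_off M) //.
  move=> b' sbb' sb' dxq; exists K; apply: invariant_add_nil (S3 b') => //; first exact: Sp.
  have qr : a q r by rewrite sa.
  split; rewrite (ndeg_p M'); last by move=> [E]; rewrite E in dq.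
  move=> _; apply: (@safe2_triangle K a' b' q p r) => //; last exact: (add_sub M).
  move=> w; rewrite (add_p M') => /orP[|/eqP]; last by left.
  by move/(ndeg1_eq dq qr); right.
have qr : a q r by rewrite sa.
have [y nyr qy] := ndeg2_other dq qr.
have [_ yp] : (r != q) * (y != p) by apply: nadj_neq => //; rewrite sa.
have yq : y != q by rewrite eq_sym adj_neq.
have fq : full a' q by rewrite /full (ndeg_p M') dq.
have nary : ~~ a r y.
  by apply/negP=> /(ndeg2_mem (eq_leq dr) pq rp rq)[]E; rewrite E eqxx in yp yq.
apply: (answered_block (x := r) (y := y)); rewrite ?(add_off M) // 1?eq_sym //.
move=> b' sbb' sb' dry; exists K; apply: invariant_add_nil (S3 b') => //.
  apply: Sp => //; rewrite dead_sym //; apply: full_dead => //.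
  by rewrite sa' (add_off M).
split; rewrite (ndeg_p M') dq // => _.
apply: (safe3_two (x := y) (y := r) (z := p)); rewrite ?(ndeg_p M') ?dq //.
- exact: (add_sub M).
- exact: (add_sub M).
- by rewrite sa'.
- by rewrite dead_sym.
rewrite dead_sym //; apply: full_dead => //; rewrite (add_p M) (negPf yq) orbF.
apply: contra nyr => py; rewrite (common_nbr_uniq pr rq py) //.
by rewrite sa.
Qed.

End Step.

Section Answer.
Variables (K : V -> V -> Prop) (a b a' : rel V) (p q : V).
Hypotheses (I : blocker_inv K a b) (M : cmove a b a' p q).
Hypothesis c4ok :
  forall r y, a p r -> a r y -> a y q -> dead a' b p y /\ dead a' b r q.

Let sa := inv_sym I.
Let sb := inv_blk I.
Let M' : cmove a b a' q p := move_sym sa sb M.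
Let sa' := add_sym I M.

Section Triangle3.
Variables r s : V.
Hypotheses (dr : ndeg a r = 3) (rp : a r p) (rq : a r q) (rs : a r s).
Hypotheses (sp : s != p) (sq : s != q).

Lemma triangle3_invariant b' : subrel b b' -> symmetric b' ->
    dead a' b' p s -> dead a' b' q s ->
    (forall x, x != r -> a p x -> dead a' b' x q) ->
    (forall x, x != r -> a q x -> dead a' b' x p) ->
  blocker_inv K a' b'.
Proof.
move=> sbb' sb' dps dqs hp hq; apply: (invariant_add_nil I M c4ok sbb' sb').
- exact: (triangle3_safe I M (r := r) (s := s)).
- exact: (triangle3_safe I M' (r := r) (s := s)).
have pr : a p r by rewrite sa.
move=> v _; rewrite [a v p]sa => pv vq; rewrite (common_nbr_uniq I M pr rq pv vq).
have [rnp rnq] := (adj_neq I rp, adj_neq I rq).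
apply: (safe3_two (x := s) (y := p) (z := q)); rewrite ?(ndeg_off M) ?dr //.
- exact: move_neq M.
- exact: (add_sub M).
- exact: (add_sub M).
- exact: (add_sub M).
- by rewrite dead_sym.
by rewrite dead_sym.
Qed.

(** Blocker spends his reply on [p s]: any other neighbour of the stuck [q] is full and so cannot be
    joined to [p]. *)
Lemma answered_triangle3_stuck : dead a' b q s -> ndeg a p = 1 -> ~~ a p s ->
  stuck a r q -> answered b a'.
Proof.
move=> dqs dp naps [|[dq fw]]; first by rewrite /full ltnNge (move_q M).
apply: (answered_block I (x := p) (y := s)); first by rewrite eq_sym.
  by rewrite (add_p M) negb_or naps.
have pE w : a p w -> w = r by apply: ndeg1_eq; rewrite ?dp // sa.
move=> b' sbb' sb' dps; exists K; apply: triangle3_invariant => //.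
- exact: dead_sub dqs.
- by move=> x nxr /pE E; rewrite E eqxx in nxr.
move=> x nxr qx; apply: full_dead; first by apply: (full_add M); apply: fw.
have xq : x != q by rewrite eq_sym (adj_neq I).
rewrite sa' (add_p M) negb_or xq andbT; apply: contra nxr.
by move/pE=> ->.
Qed.

Lemma answered_triangle3_block : dead a' b p s -> dead a' b q s ->
  ndeg a p = 2 -> ndeg a q <= 1 -> answered b a'.
Proof.
move=> dps dqs dp dq; have pr : a p r by rewrite sa.
have [x nxr px] := ndeg2_other dp pr.
have xq : x != q by apply: contraTneq px => ->; apply: move_a M.
have xp : x != p by rewrite eq_sym (adj_neq I).
apply: (answered_block I (x := x) (y := q)) => //.
  rewrite (add_off M) //; apply: contra nxr => axq.
  by rewrite (common_nbr_uniq I M pr rq px axq).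
move=> b' sbb' sb' dxq; exists K; apply: triangle3_invariant => //.
- exact: dead_sub dps.
- exact: dead_sub dqs.
- move=> y nyr /(ndeg2_mem (eq_leq dp) nxr px pr)[->//|E].
  by rewrite E eqxx in nyr.
move=> y nyr qy; have E : y = r by apply: ndeg1_eq qy; rewrite // sa.
by rewrite E eqxx in nyr.
Qed.

(** Either neither end has a neighbour besides [r], or both ends become full and the remaining pairs
    die by themselves. *)
Lemma answered_triangle3_free : dead a' b p s -> dead a' b q s ->
  ndeg a p = ndeg a q -> answered b a'.
Proof.
move=> dps dqs dpq; left; exists K; have pr : a p r by rewrite sa.
have qr : a q r by rewrite sa.
have [dp|dp] : ndeg a p <= 1 \/ ndeg a p = 2.
  by have := move_p M; rewrite leq_eqVlt => /orP[/eqP|]; [right|left].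
  have dq : ndeg a q <= 1 by rewrite -dpq.
  apply: triangle3_invariant => // x nxr vx.
    by rewrite (ndeg1_eq dp pr vx) eqxx in nxr.
  by rewrite (ndeg1_eq dq qr vx) eqxx in nxr.
have fp : full a' p by rewrite /full (ndeg_p M) dp.
have fq : full a' q by rewrite /full (ndeg_p M') -dpq dp.
apply: triangle3_invariant => // x nxr vx; rewrite dead_sym //; apply: full_dead => //.
  rewrite (add_p M') negb_or (_ : x != p) ?andbT; last by rewrite eq_sym (adj_neq I).
  apply: contra nxr => qx; rewrite (common_nbr_uniq I M pr rq vx) //.
  by rewrite sa.
rewrite (add_p M) negb_or (_ : x != q) ?andbT; last by rewrite eq_sym (adj_neq I).
apply: contra nxr => px; rewrite (common_nbr_uniq I M pr rq px) //.
by rewrite sa.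
Qed.

(** This is [safe3] at [r] with [t = p]. If [p] had degree two it becomes full and [p s] dies; if it
    had degree one, [q] is stuck and Blocker can afford to kill [p s]. *)
Lemma triangle3_shared : dead a b q s ->
    (exists2 y, a r y && (y != p) & dead a b p y) \/
    (forall y, a r y -> ~~ a p y) /\
    (1 < ndeg a p \/ forall y, a r y -> y != p -> stuck a r y) ->
  answered b a' \/ dead a' b p s /\ dead a' b q s.
Proof.
move=> dqs opt; have dqs' := dead_add I M (b' := b) (fun _ _ => id) dqs.
have pq := move_neq M; have psn : p != s by rewrite eq_sym.
have qsn : q != s by rewrite eq_sym.
have mem w := ndeg3_mem (eq_leq dr) pq psn qsn rp rq rs (w := w).
case: opt => [[w /andP[/mem[]-> nw] d]|[nadj opt]].
- by rewrite eqxx in nw.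
- by move: (move_live M); rewrite d.
- by right; split=> //; apply: (dead_add I M) d.
have naps := nadj s rs; have pr : a p r by rewrite sa.
have [dp|dp] := ltnP 1 (ndeg a p).
  right; split=> //; apply: full_dead; first by rewrite /full (ndeg_p M).
  by rewrite (add_p M) negb_or naps.
left; apply: answered_triangle3_stuck => //.
  by apply/eqP; rewrite eqn_leq dp (ndeg_gt0 pr).
by case: opt => [|]; [rewrite ltnNge dp | apply; rewrite // eq_sym].
Qed.

End Triangle3.

Section NoTriangle.
Hypothesis notri : forall v, a p v -> a q v -> False.

Lemma free_invariant b' : subrel b b' -> symmetric b' ->
  safe K a' b' p -> safe K a' b' q -> blocker_inv K a' b'.
Proof.
move=> sbb' sb' Sp Sq; apply: (invariant_add_nil I M c4ok sbb' sb') => // v _.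
by rewrite ![a v _]sa => pv /(notri pv).
Qed.

Lemma free_nadj x : a p x -> ~~ a' x q.
Proof.
move=> px; rewrite sa' (add_p M') negb_or (_ : x != p) ?andbT.
  by apply/negP=> /(notri px).
by rewrite eq_sym (adj_neq I).
Qed.

Lemma free_full_dead b' x : full a' q -> a p x -> dead a' b' q x.
Proof. by move=> fq px; apply: full_dead => //; rewrite sa' free_nadj. Qed.

(** Every pair of neighbours of [p] that contains the full vertex [q] is dead, so at most one pair
    stays open. *)
Lemma free_full_safe b' : symmetric b' -> full a' q -> safe K a' b' p.
Proof.
move=> sb' fq; have pq' : a' p q by rewrite (add_p M) eqxx orbT.
split; rewrite (ndeg_p M) => -[dp].
  have: 0 < ndeg a p by rewrite dp.
  case/card_gt0P=> x; rewrite inE => px.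
  have dqx : dead a' b' q x by apply: free_full_dead.
  apply: safe2_dead dqx => // w; rewrite (add_p M) => /orP[|/eqP]; last by left.
  by move/(ndeg1_eq (eq_leq dp) px); right.
have: 0 < ndeg a p by rewrite dp.
case/card_gt0P=> x; rewrite inE => px.
have [y nyx py] := ndeg2_other dp px.
have qn z : a p z -> q != z.
  by move=> pz; apply: contraTneq pz => <-; apply: move_a M.
apply: (safe3_two (x := q) (y := x) (z := y)); rewrite ?(ndeg_p M) ?dp //.
- exact: qn.
- exact: qn.
- by rewrite eq_sym.
- exact: (add_sub M).
- exact: (add_sub M).
- exact: free_full_dead.
exact: free_full_dead.
Qed.

Lemma free_nadj_p y : a q y -> ~~ a' y p.
Proof.
move=> qy; rewrite sa' (add_p M) negb_or (_ : y != q) ?andbT.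
  by apply/negP=> py; apply: notri qy.
by rewrite eq_sym (adj_neq I).
Qed.

Lemma free_neq_p y : a q y -> y != p.
Proof. by move=> qy; apply: contraTneq qy => ->; apply: move_a M'. Qed.

Section QFull.
Hypothesis dq : ndeg a q = 2.

Let fq : full a' q. Proof. by rewrite /full (ndeg_p M') dq. Qed.

Lemma answered_full_block x : a q x ->
    (forall b', subrel b b' -> symmetric b' -> dead a' b' x p -> safe3 a' b' q) ->
  answered b a'.
Proof.
move=> qx S3; apply: (answered_block I (x := x) (y := p)).
- exact: free_neq_p.
- exact: free_nadj_p.
move=> b' sbb' sb' dxp; exists K; apply: free_invariant => //.
  exact: free_full_safe.
by split; rewrite (ndeg_p M') dq // => _; apply: S3.
Qed.

(** The end [p] is safe without a reply, so Blocker serves [q], with neighbours [p], [y], [z]. If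
    [y z] is dead he kills [y p]. If [y] is full and adjacent to [z], he kills [z p], as [y p] is
    dead. If [y] secured [q], he kills [z p] and [safe3] holds with [t = y], of degree two. *)
Lemma answered_full : answered b a'.
Proof.
have qp' : a' q p by rewrite (add_p M') eqxx orbT.
have dq' : ndeg a' q <= 3 by rewrite (ndeg_p M') dq.
have half y z : y != z -> a q y -> a q z ->
    a y z && full a y \/ secured K a b q y -> answered b a'.
  move=> nyz qy qz H; have [yp zp] := (free_neq_p qy, free_neq_p qz).
  have [qy' qz'] := (add_sub M qy, add_sub M qz).
  apply: (answered_full_block qz) => b' sbb' sb' dzp.
  have dpz : dead a' b' p z by rewrite dead_sym.
  case: H => [/andP[ayz fy]|[_ dy dth]].
    apply: (safe3_two (x := p) (y := y) (z := z)); rewrite // 1?eq_sym //.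
    rewrite dead_sym //; apply: full_dead; first exact: (full_add M).
    exact: free_nadj_p.
  have nayz : ~~ a y z.
    apply/negP=> ayz; have : dead a b q z.
      by apply: dth => //; rewrite eq_sym (adj_neq I).
    by rewrite /dead qz.
  have mem w : a' q w -> [\/ w = p, w = y | w = z].
    by apply: ndeg3_mem; rewrite // eq_sym.
  exists y; split=> //.
    by move=> s t /mem[]-> /mem[]->; rewrite ?eqxx.
  right; split; last by left; apply: leq_trans (ndeg_add M y); rewrite dy.
  move=> w /mem[]->; first exact: free_nadj_p.
    by rewrite (add_irr I M).
  by rewrite (add_off M) // eq_sym (adj_neq I).
have: 0 < ndeg a q by rewrite dq.
case/card_gt0P=> y; rewrite inE => qy; have [z nzy qz] := ndeg2_other dq qy.
have nyz : y != z by rewrite eq_sym.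
have [s2 _] := inv_safe I q.
have [d|/andP[ayz]||] := s2 dq y z nyz qy qz.
- apply: (answered_full_block qy) => b' sbb' sb' dyp.
  have [yp zp] := (free_neq_p qy, free_neq_p qz).
  have [qy' qz'] := (add_sub M qy, add_sub M qz).
  apply: (safe3_two (x := y) (y := z) (z := p)) => //.
  exact: (dead_add I M) d.
- case/orP=> f; first by apply: half qy qz _ => //; left; rewrite ayz.
  by apply: half qz qy _ => //; left; rewrite sa ayz.
- by move=> sec; apply: half qy qz _ => //; right.
by move=> sec; apply: half qz qy _ => //; right.
Qed.

End QFull.

Lemma answered_low : ndeg a p = 0 -> ndeg a q <= 1 -> answered b a'.
Proof.
move=> dp dq.
have Sp b' : safe K a' b' p by split; rewrite (ndeg_p M) dp.
have [dq0|dq1] : ndeg a q = 0 \/ ndeg a q = 1 by case: (ndeg a q) dq => [|[]]; auto.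
  left; exists K; apply: free_invariant => //.
  by split; rewrite (ndeg_p M') dq0.
have: 0 < ndeg a q by rewrite dq1.
case/card_gt0P=> y; rewrite inE => qy.
apply: (answered_block I (x := y) (y := p)).
- exact: free_neq_p.
- exact: free_nadj_p.
move=> b' sbb' sb' dyp; exists K; apply: free_invariant => //.
split; rewrite (ndeg_p M') dq1 // => _; apply: safe2_dead dyp => // w.
rewrite (add_p M') => /orP[|/eqP]; last by right.
by move/(ndeg1_eq dq qy); left.
Qed.

(* Both ends now have degree two and demand a reply.  Blocker serves [p] and
   [q] becomes a debtor secured by [p], which cannot secure anybody else since
   it had degree one. *)
Lemma answered_path : ndeg a p = 1 -> ndeg a q = 1 -> answered b a'.
Proof.
move=> dp dq; have: 0 < ndeg a p by rewrite dp.
case/card_gt0P=> x; rewrite inE => px.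
have nxq : x != q by apply: contraTneq px => ->; apply: move_a M.
have pE w : a' p w -> w = x \/ w = q.
  rewrite (add_p M) => /orP[|/eqP]; last by right.
  by move/(ndeg1_eq (eq_leq dp) px); left.
apply: (answered_block I (x := x) (y := q)) => //; first exact: free_nadj.
move=> b' sbb' sb' dxq.
pose K' v u := if u == p then v = q else K v u.
have sec : secured K' a' b' q p.
  split; rewrite /K' ?eqxx ?(ndeg_p M) ?dp // => z /pE[->|->].
    by rewrite dead_sym.
  by rewrite eqxx.
exists K'; apply: (invariant_add I M sbb' sb').
- move=> v u Kvu du; rewrite /K'; case: eqVneq => // E.
  by rewrite E dp in du.
- move=> u v w; rewrite /K'; case: eqVneq => [_ -> ->//|_]; exact: inv_inj I _ _ _.
- by split; rewrite (ndeg_p M) dp // => _; apply: safe2_dead dxq.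
- split; rewrite (ndeg_p M') dq // => _ s t nst qs qt.
  have: 0 < ndeg a q by rewrite dq.
  case/card_gt0P=> y; rewrite inE => qy.
  have qE w : a' q w -> w = p \/ w = y.
    rewrite (add_p M') => /orP[|/eqP]; last by left.
    by move/(ndeg1_eq (eq_leq dq) qy); right.
  have [Es|Es] := qE _ qs; first by subst s; constructor 3.
  have [Et|Et] := qE _ qt; first by subst t; constructor 4.
  by rewrite Es Et eqxx in nst.
- by move=> v _; rewrite ![a v _]sa => pv /(notri pv).
by move=> r y pr ry yq; have [] := c4ok pr ry yq; split; apply: (dead_sub sbb').
Qed.

End NoTriangle.

End Answer.

(** Three situations are treated in turn: a closed 4-cycle with a live diagonal, a closed triangle,
    and neither of these. *)
Theorem move_answered K a b a' p q :
  blocker_inv K a b -> cmove a b a' p q -> answered b a'.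
Proof.
move=> I M; have [sa sb] := (inv_sym I, inv_blk I).
have M' := move_sym sa sb M; have sa' := add_sym I M.
have [/existsP[r /existsP[y /and4P[pr ry yq]]]|noc4] := boolP [exists r, exists y,
    [&& a p r, a r y, a y q & ~~ dead a' b p y]].
  exact: (answered_c4 I M pr ry yq).
have [/existsP[r /existsP[y /and4P[qr ry yp]]]|noc4'] := boolP [exists r, exists y,
    [&& a q r, a r y, a y p & ~~ dead a' b q y]].
  exact: (answered_c4 I M' qr ry yp).
have c4 r y : a p r -> a r y -> a y q -> dead a' b p y /\ dead a' b r q.
  move=> pr ry yq; split.
    apply: contraNT noc4 => d; apply/existsP; exists r; apply/existsP; exists y.
    by rewrite pr ry yq.
  apply: contraNT noc4' => d; apply/existsP; exists y; apply/existsP; exists r.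
  by rewrite [a q y]sa [a y r]sa [a r p]sa yq ry pr dead_sym.
have c4' r y : a q r -> a r y -> a y p -> dead a' b q y /\ dead a' b r p.
  move=> qr ry yp; have [|||dpr dyq] := c4 y r; rewrite // 1?sa //.
  by split; rewrite dead_sym.
have mid d : d <= 2 -> [\/ d = 0, d = 1 | d = 2].
  by case: d => [|[|[|d]]] // _; [constructor 1|constructor 2|constructor 3].
have [/existsP[r /andP[rp rq]]|notri] := boolP [exists r, a r p && a r q].
  have dr1 : 1 < ndeg a r by apply: ndeg_gt1 (move_neq M) rp rq.
  have [dr|dr] := nat_2or3 dr1 (inv_deg I r).
    have [d|/andP[pq _]|sec|sec] := (inv_safe I r).1 dr _ _ (move_neq M) rp rq.
    - by move: (move_live M); rewrite d.
    - by move: (move_a M); rewrite pq.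
    - exact: (answered_triangle2 I M c4 dr).
    - exact: (answered_triangle2 I M' c4' dr).
  have [s [sp sq rs]] := ndeg3_other dr (move_neq M) rp rq.
  (* The case split is on the vertex [t] of [safe3] at [r]; [t = s] is impossible, as it would make
     [p q] dead. *)
  have [//|[dps dqs]] : answered b a' \/ dead a' b p s /\ dead a' b q s.
    have [psn qsn] : p != s /\ q != s by rewrite ![_ == s]eq_sym.
    have [t [rt dth opt]] := (inv_safe I r).2 dr.
    have [] := ndeg3_mem (eq_leq dr) (move_neq M) psn qsn rp rq rs rt => Et; subst t.
    - apply: (triangle3_shared I M c4 dr rp rq rs sp sq _ opt).
      by apply: dth; rewrite // eq_sym (move_neq M).
    - have dps : dead a b p s by apply: dth; rewrite // (move_neq M).
      have [|[]] := triangle3_shared I M' c4' dr rq rp rs sq sp dps opt; auto.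
    - by move: (move_live M); rewrite dth // (move_neq M).
  have [pr qr] : a p r /\ a q r by rewrite ![a _ r]sa.
  have [dp|dp|dp] := mid _ (move_p M); have [dq|dq|dq] := mid _ (move_q M).
  all: try by [have := ndeg_gt0 pr; rewrite dp | have := ndeg_gt0 qr; rewrite dq].
  - by apply: (answered_triangle3_free I M c4 dr rp rq rs); rewrite ?dp.
  - by apply: (answered_triangle3_block I M' c4' dr rq rp rs); rewrite ?dp.
  - by apply: (answered_triangle3_block I M c4 dr rp rq rs); rewrite ?dq.
  - by apply: (answered_triangle3_free I M c4 dr rp rq rs); rewrite ?dp.
have nt v : a p v -> a q v -> False.
  move=> pv qv; move/existsP: notri; apply; exists v.
  by rewrite ![a v _]sa pv.
have nt' v : a q v -> a p v -> False by move=> qv pv; apply: nt qv.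
have [dp|dp|dp] := mid _ (move_p M); have [dq|dq|dq] := mid _ (move_q M).
- by apply: (answered_low I M c4 nt); rewrite ?dq.
- by apply: (answered_low I M c4 nt); rewrite ?dq.
- exact: (answered_full I M c4 nt dq).
- by apply: (answered_low I M' c4' nt'); rewrite ?dp.
- exact: (answered_path I M c4 nt).
- exact: (answered_full I M c4 nt dq).
- exact: (answered_full I M' c4' nt' dp).
- exact: (answered_full I M' c4' nt' dp).
exact: (answered_full I M c4 nt dq).
Qed.

End Diamonds.

(** * The upper bound *)

Lemma inv_mono (V : finType) (K : V -> V -> Prop) (a b b' : rel V) :
  blocker_inv K a b -> subrel b b' -> symmetric b' -> blocker_inv K a b'.
Proof.
move=> [sa ia sb da injK sf c4] sbb' sb'.
have D x y : dead a b x y -> dead a b' x y.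
  by rewrite /dead => /andP[-> /orP[/sbb'->|->]]; rewrite ?orbT.
have S v u : secured K a b v u -> secured K a b' v u.
  by case=> Kvu du dth; split=> // z uz nz; apply/D/dth.
split=> //; last by move=> x y r s *; apply/D/(c4 x y r s).
move=> v; have [s2 s3] := sf v; split=> dv.
  move=> x y nxy vx vy; have [] := s2 dv x y nxy vx vy.
  - by move/D; constructor 1.
  - by constructor 2.
  - by move/S; constructor 3.
  - by move/S; constructor 4.
have [t [vt dth opt]] := s3 dv; exists t; split=> //.
  by move=> y z *; apply/D/dth.
by case: opt => [[y ? /D]|]; [left; exists y|right].
Qed.

Section Graphs.
Variable n : nat.
Implicit Types (C B : graph n) (e f T : {set 'I_n}) (p q v x y : 'I_n).

Definition adj C : rel 'I_n := fun x y => [set x; y] \in C.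

Definition simple C := forall e, e \in C -> is_edge e.

Lemma adj_sym C : symmetric (adj C).
Proof. by move=> x y; rewrite /adj setUC. Qed.

Lemma set2_eq (V : finType) (x y p q : V) :
  ([set x; y] == [set p; q]) = (x == p) && (y == q) || (x == q) && (y == p).
Proof.
apply/eqP/idP=> [E|/orP[]/andP[/eqP-> /eqP->]]; rewrite 1?setUC //.
have : x \in [set p; q] by rewrite -E set21.
have : y \in [set p; q] by rewrite -E set22.
have : p \in [set x; y] by rewrite E set21.
have : q \in [set x; y] by rewrite E set22.
rewrite !inE ![_ == x]eq_sym ![_ == y]eq_sym.
by case: (x == p); case: (x == q); case: (y == p); case: (y == q).
Qed.

Lemma adj_add C p q x y : adj ([set p; q] |: C) x y = add_edge (adj C) p q x y.
Proof. by rewrite /adj in_setU1 set2_eq /add_edge orbC. Qed.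

Lemma deg_adj C v : simple C -> deg C v = ndeg (adj C) v.
Proof.
move=> sC; rewrite /ndeg -(@card_in_imset _ _ (fun w => [set v; w])); last first.
  move=> x y; rewrite !inE => vx _ /eqP; rewrite set2_eq eqxx /=.
  by case/orP=> [/eqP//|/andP[/eqP<- /eqP->]].
apply: eq_card => e; apply/setIdP/imsetP=> [[eC ve]|[w]]; last first.
  by rewrite inE => vw ->; rewrite set21.
have := sC _ eC; rewrite /is_edge => /cards2P[x [y [nxy E]]].
move: eC ve; rewrite E => eC.
rewrite !inE => /orP[]/eqP Ev; subst v; [exists y | exists x];
  by rewrite ?inE /adj // setUC.
Qed.

Lemma deg_add C e v : e \notin C -> deg (e |: C) v = deg C v + (v \in e).
Proof.
move=> eC; rewrite /deg; have [ve|ve] := boolP (v \in e).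
  rewrite (_ : [set f in e |: C | v \in f] = e |: [set f in C | v \in f]).
    by rewrite cardsU1 inE (negPf eC) addnC.
  by apply/setP=> f; rewrite !inE; case: eqVneq => // ->; rewrite ve.
rewrite addn0; apply: eq_card => f; rewrite !inE.
by case: eqVneq => // ->; rewrite (negPf ve) !andbF.
Qed.

Lemma triangle_adj C T x y :
    [forall e : {set 'I_n}, (e \subset T) && (#|e| == 2) ==> (e \in C)] ->
  x \in T -> y \in T -> x != y -> adj C x y.
Proof.
move=> /forallP/(_ [set x; y])/implyP tC xT yT nxy; apply: tC.
by rewrite cards2 nxy subUset !sub1set xT yT.
Qed.

Lemma card3_other T v : #|T| == 3 -> v \in T ->
  exists x y, [/\ x != y, x != v, y != v & T = [set v; x; y]].
Proof.
move=> T3 vT; have /cards2P[x [y [nxy E]]] : #|T :\ v| == 2.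
  by move: T3; rewrite (cardsD1 v) vT.
have [] : x \in T :\ v /\ y \in T :\ v by rewrite E set21 set22.
rewrite !inE => /andP[xv _] /andP[yv _]; exists x, y; split=> //.
by rewrite -(setD1K vT) E setUA.
Qed.

(** Two triangles meeting in [v] draw on at most three neighbours of [v], so they share an edge
    [v s]. If they differed, [v s] would be the diagonal of a 4-cycle. Hence the triangles are
    disjoint. *)
Lemma inv_triangles K C b : blocker_inv K (adj C) b -> triangles C <= n %/ 3.
Proof.
move=> I; rewrite leq_divRL // /triangles; set Ts := [set T | _].
have triv : trivIset Ts.
{ apply/trivIsetP=> T T'; rewrite !inE => /andP[T3 TC] /andP[T3' TC'].
  apply: contraNT => /pred0Pn[v /andP[/= vT vT']].
  have [x [y [nxy xv yv E]]] := card3_other T3 vT.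
  have [z [w [nzw zv wv E']]] := card3_other T3' vT'.
  have aT s t : s \in T -> t \in T -> s != t -> adj C s t by apply: triangle_adj TC.
  have aT' s t : s \in T' -> t \in T' -> s != t -> adj C s t by apply: triangle_adj TC'.
  have [xT yT] : x \in T /\ y \in T by rewrite E !inE !eqxx !orbT.
  have [zT wT] : z \in T' /\ w \in T' by rewrite E' !inE !eqxx !orbT.
  have sh s t t' : s \in T -> s \in T' -> s != v -> t \in T -> t' \in T' ->
      t != v -> t' != v -> t != s -> t' != s -> t = t'.
    move=> sT sT' sv tT tT' tv t'v ts t's; apply/eqP; apply: contraT => ntt'.
    have : dead (adj C) b v s.
      apply: (inv_c4 I _ ntt'); first by rewrite eq_sym.
      - by apply: aT; rewrite // eq_sym.
      - by apply: aT'; rewrite // eq_sym.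
      - by apply: aT; rewrite // eq_sym.
      - by apply: aT'; rewrite // eq_sym.
    by rewrite /dead aT // eq_sym.
  have [] : [\/ w = x, w = y | w = z] \/ [\/ z = x, z = y | z = w].
    have [->|nzx] := eqVneq z x; first by right; constructor 1.
    have [->|nzy] := eqVneq z y; first by right; constructor 2.
    left; apply: (ndeg3_mem (inv_deg I v)) => //; rewrite 1?eq_sym //.
    + by apply: aT; rewrite // eq_sym.
    + by apply: aT; rewrite // eq_sym.
    + by apply: aT'; rewrite // eq_sym.
    + by apply: aT'; rewrite // eq_sym.
  all: case=> Ew; first [subst w | subst z].
  all: rewrite ?eqxx // in nzw *.
  all: apply/eqP; rewrite E E'.
  - by rewrite (sh x y z) // 1?eq_sym //; apply/setP=> u; rewrite !inE orbAC.
  - by rewrite (sh y x z) // 1?eq_sym.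
  - by rewrite (sh x y w) // 1?eq_sym.
  - by rewrite (sh y x w) // 1?eq_sym //; apply/setP=> u; rewrite !inE orbAC. }
have := triv; rewrite /trivIset => /eqP cov.
have -> : #|Ts| * 3 = \sum_(T in Ts) #|T|.
  by rewrite -sum_nat_const; apply: eq_bigr => T; rewrite inE => /andP[/eqP].
by rewrite cov -[leqRHS]card_ord max_card.
Qed.

Definition guarded C B := simple C /\ exists K, blocker_inv K (adj C) (adj B).

Lemma guarded0 : guarded set0 set0.
Proof.
split; first by move=> e; rewrite inE.
have a0 x y : adj (set0 : graph n) x y = false by rewrite /adj inE.
have d0 v : ndeg (adj (set0 : graph n)) v = 0.
  by apply/eqP; rewrite cards_eq0; apply/eqP/setP=> w; rewrite !inE a0.
exists (fun _ _ => False); split.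
- exact: adj_sym.
- by move=> x; rewrite a0.
- exact: adj_sym.
- by move=> v; rewrite d0.
- by [].
- by move=> v; split; rewrite d0.
by move=> x y r s _ _; rewrite a0.
Qed.

Lemma guarded_mono C B B' : guarded C B -> B \subset B' -> guarded C B'.
Proof.
case=> sC [K I] /subsetP sBB'; split=> //; exists K.
by apply: inv_mono I _ (adj_sym B') => x y; apply: sBB'.
Qed.

Lemma guarded_step C B e : guarded C B -> e \in legal C B ->
  guarded (e |: C) B \/
  exists2 f, is_edge f && (f \notin e |: C) & guarded (e |: C) (f |: B).
Proof.
case=> sC [K I]; rewrite mem_legal mem_unclaimed => /and4P[/forallP free eE eC eB].
have sC' : simple (e |: C) by move=> f; rewrite !inE => /orP[/eqP->//|/sC].
have {}free v : v \in e -> ndeg (adj C) v <= 2.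
  move=> ve; rewrite -deg_adj //; have := free v.
  by rewrite deg_add // ve addn1.
move: (eE); rewrite /is_edge => /cards2P[p [q [npq Ee]]].
have M : cmove (adj C) (adj B) (adj (e |: C)) p q.
  split=> //; last by move=> x y; rewrite Ee adj_add.
  - by rewrite /adj -Ee.
  - by rewrite /adj -Ee.
  - by apply: free; rewrite Ee set21.
  - by apply: free; rewrite Ee set22.
case: (move_answered I M) => [[K' I']|[x [y [nxy naxy [K' I']]]]].
  by left; split=> //; exists K'.
right; exists [set x; y]; first by rewrite /is_edge cards2 nxy.
split=> //; exists K'; apply: inv_mono I' _ (adj_sym _) => u v.
by rewrite adj_add.
Qed.

Lemma g_K3_S4_leq : g_K3_S4 n <= n %/ 3.
Proof.
apply: (blocker_strategy (P := guarded)); first 1 last.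
- exact: guarded_mono.
- exact: guarded_step.
- exact: guarded0.
by move=> C B [_ [K I]]; apply: inv_triangles I.
Qed.

End Graphs.

(** * The lower bound *)

Section Construct.
Variable n : nat.
Implicit Types (C B : graph n) (F R : {set 'I_n}) (c v w x y z : 'I_n).

Lemma triangles_mono C C' : C \subset C' -> triangles C <= triangles C'.
Proof.
move/subsetP=> sCC'; apply/subset_leq_card/subsetP=> T; rewrite !inE.
case/andP=> -> /forallP TC; apply/forallP=> e; apply/implyP=> eT.
by apply: sCC'; apply: (implyP (TC e)).
Qed.

Lemma triangles_lt C C' x y z : C \subset C' -> x != y -> x != z -> y != z ->
    adj C' x y -> adj C' x z -> adj C' y z -> ~~ adj C x y ->
  triangles C < triangles C'.
Proof.
move=> sCC' xy xz yz axy axz ayz naxy; apply: proper_card.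
have T3 : #|[set x; y; z]| == 3.
  by rewrite setUC cardsU1 cards2 xy !inE negb_or ![z == _]eq_sym xz yz.
apply/properP; split; last exists [set x; y; z]; rewrite ?inE ?T3 /=.
- apply/subsetP=> T; rewrite !inE => /andP[-> /forallP TC].
  apply/forallP=> e; apply/implyP=> eT.
  by apply: (subsetP sCC'); apply: (implyP (TC e)).
- apply/forallP=> e; apply/implyP=> /andP[/subsetP eT /cards2P[u [v [uv Ee]]]].
  have [] : u \in [set x; y; z] /\ v \in [set x; y; z].
    by split; apply: eT; rewrite Ee !inE eqxx ?orbT.
  rewrite !inE Ee -!orbA => /or3P[]/eqP Eu /or3P[]/eqP Ev; subst u v;
    rewrite ?eqxx // in uv *; by rewrite setUC.
apply: contra naxy => /forallP/(_ [set x; y]); rewrite cards2 xy /= subUset.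
by rewrite !sub1set !inE !eqxx !orbT.
Qed.

Lemma triangles_game_val fuel C B turn : triangles C <= game_val fuel C B turn.
Proof.
elim: fuel C B turn => [//|fuel IH] C B [].
  have [L|L] := eqVneq (legal C B) [::]; first by rewrite game_val_legal0.
  rewrite game_val_constructor //.
  case E: (legal C B) L => [|e l] // _.
  apply: leq_trans (leq_maxseq (mem_head _ _)); apply: leq_trans (IH _ _ _).
  exact/triangles_mono/subsetUr.
have [U|U] := eqVneq (unclaimed C B) [::]; first by rewrite game_val_unclaimed0.
rewrite game_val_blocker //; apply: leq_minseq; first by case: (unclaimed _ _) U.
by move=> _ /mapP[f _ ->].
Qed.

Lemma sum_deg B : simple B -> \sum_v deg B v = 2 * #|B|.
Proof.
move=> sB; rewrite (eq_bigr (fun v => \sum_(e in B | v \in e) 1)); last first.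
  by move=> v _; rewrite sum1dep_card; apply: eq_card => e; rewrite !inE.
rewrite (exchange_big_dep (mem B)) /= => [|v e _ /andP[]//].
rewrite mulnC -sum_nat_const; apply: eq_bigr => e eB.
rewrite sum1dep_card; have /eqP <- := sB _ eB; apply: eq_card => v.
by rewrite !inE eB.
Qed.

(** Otherwise at least [#|F| - m] vertices would each contribute [D + 1] to the degree sum. *)
Lemma low_degree B F D m : simple B -> 2 * #|B| < D.+1 * (#|F| - m) ->
  m < #|[set v in F | deg B v <= D]|.
Proof.
move=> sB; apply: contraTltn => low; rewrite -leqNgt -sum_deg //.
set H := [set v in F | D < deg B v].
have FH : #|F| - m <= #|H|.
  rewrite leq_subLR; apply: leq_trans (leq_add low (leqnn _)).
  apply: leq_trans (leq_card_setU _ _); apply/subset_leq_card/subsetP=> v vF.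
  by rewrite !inE vF /= leqNgt orNb.
apply: leq_trans (_ : \sum_(v in H) deg B v <= _); last first.
  by rewrite [leqRHS](bigID (mem H)) /= leq_addr.
apply: leq_trans (leq_mul (leqnn _) FH) _; rewrite mulnC -sum_nat_const.
by apply: leq_sum => v; rewrite inE => /andP[].
Qed.

Lemma pick_outside (S X : {set 'I_n}) : #|X| < #|S| -> exists2 v, v \in S & v \notin X.
Proof.
move=> XS; have : ~~ (S \subset X) by apply: contraL XS => /subset_leq_card; rewrite -leqNgt.
by case/subsetPn=> v; exists v.
Qed.

Definition nbrs B v : {set 'I_n} := [set w | adj B v w].

Lemma card_nbrs B v : simple B -> #|nbrs B v| = deg B v.
Proof. by move=> sB; rewrite deg_adj. Qed.

Lemma legal_pair C B x y : x != y -> ~~ adj C x y -> ~~ adj B x y ->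
    (forall v, deg C v <= 3) -> deg C x <= 2 -> deg C y <= 2 ->
  [set x; y] \in legal C B.
Proof.
move=> xy nC nB d3 dx dy; rewrite mem_legal mem_unclaimed /is_edge cards2 xy nC nB.
rewrite /= andbT; apply/forallP=> v; rewrite deg_add // ltnS !inE.
have [->|vx] := eqVneq v x; first by rewrite addn1.
by have [->|vy] := eqVneq v y; rewrite ?addn1 // addn0.
Qed.

Lemma deg0_nadj C x y : deg C x = 0 -> ~~ adj C x y.
Proof.
move=> /eqP; rewrite cards_eq0 => /eqP d0; apply/negP=> xy.
by have := in_set0 [set x; y]; rewrite -d0 inE set21 andbT -/(adj C x y) xy.
Qed.

(** The inclusions also allow [B' = B], which occurs when no edge is left to Blocker. *)
Definition reply B B' := [/\ B \subset B', simple B' &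
  exists f, B' \subset f |: B].

Lemma reply_deg B B' v : reply B B' -> deg B' v <= (deg B v).+1.
Proof.
case=> _ _ [f sB']; apply: leq_trans (_ : #|f |: [set e in B | v \in e]| <= _).
  apply/subset_leq_card/subsetP=> e; rewrite !inE => /andP[/(subsetP sB')].
  by rewrite !inE => /orP[->|->] // ->; rewrite orbT.
by rewrite cardsU1; case: (_ \notin _) => //; apply: ltnW.
Qed.

Lemma reply_card B B' : reply B B' -> #|B'| <= #|B|.+1.
Proof.
case=> _ _ [f sB']; apply: leq_trans (subset_leq_card sB') _.
by rewrite cardsU1; case: (_ \notin _) => //; apply: ltnW.
Qed.

Lemma constructor_move fuel C B x y m : simple B ->
    x != y -> ~~ adj C x y -> ~~ adj B x y ->
    (forall v, deg C v <= 3) -> deg C x <= 2 -> deg C y <= 2 ->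
    (forall B', reply B B' -> (forall v, deg ([set x; y] |: C) v <= 3) ->
       m <= game_val fuel ([set x; y] |: C) B' true) ->
  m <= game_val fuel.+2 C B true.
Proof.
move=> sB xy nC nB d3 dx dy H; have eL := legal_pair xy nC nB d3 dx dy.
apply: (constructor_round eL) => B' sBB' [f fE sB'f]; apply: H; last first.
  by move=> v; have := eL; rewrite mem_legal => /andP[/forallP/(_ v)].
split=> //; last by exists f.
by move=> e /(subsetP sB'f); rewrite !inE => /orP[/eqP->|/sB].
Qed.

(** [F] holds the fresh vertices and [R] the reserve. Blocker's degrees are not constrained here;
    they are controlled by counting his edges. *)
Record stock C B F R : Prop := Stock {
  stock_simple : simple B;
  stock_deg : forall v, deg C v <= 3;
  stock_F : forall v, v \in F -> deg C v = 0;
  stock_R : forall v, v \in R -> deg C v <= 1;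
  stock_disj : [disjoint F & R] }.

Lemma stock_round D fuel C B F R m :
    stock C B F R ->
    2 * #|B|.+1 < D.+1 * (#|F| - (2 * D + 4)) -> 3 * (D + 2) < #|R| ->
    (forall C' B' F' R', stock C' B' F' R' -> #|B'| <= #|B| + 4 ->
       #|F| <= #|F'| + 3 -> #|R'| = #|R| -> triangles C < triangles C' ->
       m <= game_val fuel C' B' true) ->
  m <= game_val fuel.+4.+4 C B true.
Proof.
case=> sB d3 F0 R1 FR szF szR next.
have nadj0 v w : v \in F -> ~~ adj C v w by move=> vF; apply/deg0_nadj/F0.
have notR v w : v \in F -> w \in R -> w != v.
  by move=> vF; apply: contraTneq => ->; rewrite (disjointFr FR).
have low := low_degree sB (leq_ltn_trans (leq_mul (leqnn 2) (leqnSn _)) szF).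
have [|c] := @pick_outside [set v in F | deg B v <= D] set0.
  by rewrite cards0; apply: leq_ltn_trans low.
rewrite inE => /andP[cF cD] _.
have [|x] := @pick_outside [set v in F | deg B v <= D] (c |: nbrs B c).
  apply: leq_ltn_trans low; rewrite cardsU1 card_nbrs //.
  by move: cD; case: (_ \notin _); lia.
rewrite !inE => /andP[xF xD] /norP[xc cxB].
have cx : c != x by rewrite eq_sym.
apply: (constructor_move sB cx); rewrite ?F0 ?nadj0 //.
set C1 := [set c; x] |: C; move=> B1 rB1 d31; have [_ sB1 _] := rB1.
have szF1 : 2 * #|B1| < D.+1 * (#|F| - (2 * D + 4)).
  by apply: leq_ltn_trans szF; rewrite leq_mul2l; apply: reply_card.
(* To be avoided are [c], [x] and their Blocker-neighbours, at most [D + 1] for each after one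
   reply: [2 * D + 4] vertices in all. *)
have [|y] := @pick_outside [set v in F | deg B1 v <= D]
    ([set c; x] :|: (nbrs B1 c :|: nbrs B1 x)).
  apply: leq_ltn_trans (low_degree sB1 szF1).
  apply: leq_trans (leq_card_setU _ _) _; rewrite cards2 cx.
  apply: leq_trans (leq_add (leqnn _) (leq_card_setU _ _)) _; rewrite !card_nbrs //.
  have := reply_deg c rB1; have := reply_deg x rB1; move: cD xD.
  by clear; lia.
rewrite !inE => /andP[yF yD] /norP[/norP[yc yx] /norP[cyB xyB]].
have cy : c != y by rewrite eq_sym.
have xy : x != y by rewrite eq_sym.
have deg1 v : deg C1 v = deg C v + (v \in [set c; x]) by apply/deg_add/nadj0.
have c1 : deg C1 c = 1 by rewrite deg1 F0 // !inE eqxx.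
have x1 : deg C1 x = 1 by rewrite deg1 F0 // !inE eqxx orbT.
have y1 : deg C1 y = 0 by rewrite deg1 F0 // !inE (negPf yc) (negPf yx).
have nadj1 : ~~ adj C1 c y by rewrite adj_sym; apply: deg0_nadj.
apply: (constructor_move sB1 cy); rewrite ?c1 ?y1 //.
set C2 := [set c; y] |: C1.
move=> B2 rB2 d32; have [_ sB2 _] := rB2.
(* After two replies each of [c], [x], [y] has Blocker-degree at most [D + 2], so a reserve of more
   than [3 * (D + 2)] vertices suffices. *)
have [|z zR] := @pick_outside R (nbrs B2 c :|: (nbrs B2 x :|: nbrs B2 y)).
  apply: leq_ltn_trans szR.
  apply: leq_trans (leq_card_setU _ _) _.
  apply: leq_trans (leq_add (leqnn _) (leq_card_setU _ _)) _; rewrite !card_nbrs //.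
  have := reply_deg c rB1; have := reply_deg x rB1.
  have := reply_deg c rB2; have := reply_deg x rB2; have := reply_deg y rB2.
  by move: cD xD yD; clear; lia.
rewrite !inE => /norP[czB /norP[xzB yzB]].
have [[zc zx] zy] := (notR _ _ cF zR, notR _ _ xF zR, notR _ _ yF zR).
have [cz xz yz] : [/\ c != z, x != z & y != z] by rewrite ![_ == z]eq_sym.
have deg2 v : deg C2 v = deg C1 v + (v \in [set c; y]) by apply/deg_add.
have z1 : deg C1 z <= 1 by rewrite deg1 !inE (negPf zc) (negPf zx) addn0 R1.
have c2 : deg C2 c = 2 by rewrite deg2 c1 !inE eqxx.
have x2 : deg C2 x = 1 by rewrite deg2 x1 !inE (negPf xc) (negPf xy).
have y2 : deg C2 y = 1 by rewrite deg2 y1 !inE eqxx orbT.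
have z2 : deg C2 z <= 1 by rewrite deg2 !inE (negPf zc) (negPf zy) addn0.
have nadj2 : ~~ adj C2 c z.
  rewrite /adj /C2 /C1 !in_setU1 -/(adj C c z) (negPf (nadj0 c z cF)) !set2_eq.
  by rewrite eqxx (negPf zx) (negPf zy) (negPf cx) (negPf cy).
apply: (constructor_move sB2 cz); rewrite ?c2 ?(leq_trans z2) //.
set C3 := [set c; z] |: C2; move=> B3 rB3 d33; have [_ sB3 [f sB3f]] := rB3.
have deg3 v : deg C3 v = deg C2 v + (v \in [set c; z]) by apply/deg_add.
have c3 : deg C3 c = 3 by rewrite deg3 c2 !inE eqxx.
have x3 : deg C3 x = 1 by rewrite deg3 x2 !inE (negPf xc) (negPf xz).
have y3 : deg C3 y = 1 by rewrite deg3 y2 !inE (negPf yc) (negPf yz).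
have z3 : deg C3 z <= 2 by rewrite deg3 !inE eqxx orbT addn1.
have sC v w : adj C3 v w = [|| adj C v w, [set v; w] == [set c; x],
    [set v; w] == [set c; y] | [set v; w] == [set c; z]].
  rewrite /adj /C3 /C2 /C1 !in_setU1.
  by do 3!case: (_ == _); rewrite ?orbT ?orbF.
have nadj3 u : u \in F -> u != c -> ~~ adj C3 u z.
  move=> uF uc; rewrite sC (negPf (nadj0 u z uF)) !set2_eq (negPf uc).
  by rewrite (negPf zc) !andbF.
(* The vertex [u'] replaces [z] in the reserve. *)
have close u u' : u \in F -> u' \in F -> u != c -> u' != c -> u != u' ->
    deg C3 u = 1 -> deg C3 u' = 1 -> adj C3 c u ->
    (forall v, v != c -> v != u -> v != u' -> v != z -> deg C3 v = deg C v) ->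
    ~~ adj B3 u z -> m <= game_val fuel.+2 C3 B3 true.
  move=> uF u'F uc u'c uu' du du' cu off nB3.
  have uz : u != z by rewrite eq_sym notR.
  apply: (constructor_move sB3 uz); rewrite ?du ?z3 ?nadj3 //.
  set C4 := [set u; z] |: C3; move=> B4 rB4 d34; have [_ sB4 _] := rB4.
  have deg4 v : deg C4 v = deg C3 v + (v \in [set u; z]) by apply/deg_add/nadj3.
  apply: (next C4 B4 (F :\ c :\ u :\ u') (u' |: R :\ z)).
  - split=> // [v|v|].
    + rewrite !inE => /and4P[vu' vu vc vF].
      have vz : v != z by rewrite eq_sym notR.
      by rewrite deg4 off // F0 // !inE (negPf vu) (negPf vz).
    + rewrite !inE => /orP[/eqP->|/andP[vz vR]].
        by rewrite deg4 du' !inE eq_sym (negPf uu') eq_sym (negPf (notR _ _ u'F zR)).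
      have [[vc vu] vu'] := (notR _ _ cF vR, notR _ _ uF vR, notR _ _ u'F vR).
      by rewrite deg4 off // !inE (negPf vz) (negPf vu) addn0 R1.
    apply/pred0P=> v /=; rewrite !inE; apply/negP.
    case/andP=> /and4P[vu' _ _ vF] /orP[/eqP E|/andP[_ vR]].
      by rewrite E eqxx in vu'.
    by rewrite (disjointFr FR vF) in vR.
  - move: (reply_card rB1) (reply_card rB2) (reply_card rB3) (reply_card rB4).
    by clear; lia.
  - rewrite (cardsD1 c F) cF (cardsD1 u) (cardsD1 u' (_ :\ u)) !inE.
    rewrite uF uc u'F u'c [u' == u]eq_sym uu' /=.
    by clear; lia.
  - rewrite cardsU1 !inE (cardsD1 z R) zR (disjointFr FR u'F) andbF //.
  apply: (@triangles_lt _ _ c z u) => //.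
  - apply/subsetP=> e eC; rewrite !inE eC !orbT //.
  - by rewrite eq_sym.
  - by rewrite eq_sym.
  - by rewrite /adj /C4 /C3 !in_setU1 eqxx orbT.
  - by rewrite /adj /C4 in_setU1 -/(adj C3 c u) cu orbT.
  - by rewrite adj_sym /adj /C4 in_setU1 eqxx.
  - exact: nadj0.
have off v : v != c -> v != x -> v != y -> v != z -> deg C3 v = deg C v.
  move=> vc vx vy vz; rewrite deg3 deg2 deg1 !inE.
  by rewrite (negPf vc) (negPf vx) (negPf vy) (negPf vz) !addn0.
have cx3 : adj C3 c x by rewrite sC eqxx orbT.
have cy3 : adj C3 c y by rewrite sC eqxx !orbT.
have [nxz|] := boolP (~~ adj B3 x z); first exact: (close x y).
rewrite negbK => xzB3; apply: (close y x) => //; first by move=> v *; apply: off.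
(* Both [x z] and [y z] were outside [B2], and the reply to [c z] adds only one edge. *)
apply/negP=> yzB3; move: (subsetP sB3f _ xzB3) (subsetP sB3f _ yzB3).
rewrite !inE -!/(adj _ _ _) (negPf xzB) (negPf yzB) !orbF => /eqP <-.
by rewrite set2_eq (negPf yx) (negPf yz).
Qed.

(** Each round costs at most four Blocker edges, three fresh vertices and eight units of fuel. The
    numerical hypotheses are stated for the end of the [s] rounds, so they pass to the next
    round. *)
Lemma stock_value D s fuel C B F R :
    stock C B F R -> 3 * (D + 2) < #|R| ->
    2 * (#|B| + 4 * s) < D.+1 * (#|F| - 3 * s - (2 * D + 4)) -> 8 * s <= fuel ->
  triangles C + s <= game_val fuel C B true.
Proof.
elim: s fuel C B F R => [|s IHs] fuel C B F R SC szR szF szf.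
  by rewrite addn0 triangles_game_val.
have [fuel' Ef] : exists fuel', fuel = fuel'.+4.+4.
  by exists (fuel - 8); move: szf; clear; lia.
subst fuel; apply: (stock_round SC _ szR).
  apply: leq_ltn_trans (leq_trans szF _); first by clear; lia.
  by rewrite leq_mul2l; apply/orP; right; clear; lia.
move=> C' B' F' R' SC' szB' szF' szR' tri.
apply: leq_trans (IHs fuel' C' B' F' R' SC' _ _ _).
- by rewrite addnS -addSn leq_add2r.
- by rewrite szR'.
- apply: leq_ltn_trans (leq_trans szF _).
    by move: szB'; clear; lia.
  by rewrite leq_mul2l; apply/orP; right; move: szF'; clear; lia.
by move: szf; clear; lia.
Qed.

Lemma stock_start M : M <= n ->
  exists F R, [/\ stock set0 set0 F R, #|F| = n - M & #|R| = M].
Proof.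
move=> leMn; pose R := [set i : 'I_n | i < M].
have cR : #|R| = M.
  have inj : injective (widen_ord leMn) by move=> i j /(congr1 val)/= /val_inj.
  rewrite -[RHS]card_ord -(card_imset predT inj).
  apply: eq_card => i; rewrite inE; apply/idP/imsetP => [iM|[j _ ->]]; last exact: ltn_ord j.
  by exists (Ordinal iM) => //; apply: val_inj.
have d0 v : deg (set0 : graph n) v = 0.
  by apply/eqP; rewrite cards_eq0; apply/eqP/setP=> e; rewrite !inE.
exists (~: R), R; split=> //; last first.
  by rewrite -[n in RHS]card_ord -(cardsC R) cR addKn.
split=> // [e|v|v|]; rewrite ?d0 ?inE //.
by rewrite disjoints_subset.
Qed.

(* Blocker claims at most four edges in each of at most [n / 3] rounds, so fewer
   than [n / k] vertices can exceed Blocker-degree [8 k]. *)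
Lemma g_K3_S4_geq k : 0 < k -> k * (40 * k + 20) <= n ->
  k * n <= 3 * (k * g_K3_S4 n) + 2 * n.
Proof.
(* [c] is the size of the reserve plus the [2 * D + 4] vertices avoided in a round. If [s] is
   positive, its choice leaves more than [n %/ k] further fresh vertices after [s] rounds. *)
move=> k0 nk; set D := 8 * k; set c := 3 * (D + 2) + 1 + (2 * D + 4).
pose s := (n - n %/ k - c.+1) %/ 3.
(* Here [c + 3 = 40 * k + 14], whence the size required of [n]. *)
have cn : c.+3 <= n %/ k by rewrite leq_divRL // /c /D; move: nk; clear; nia.
have qn : n %/ k * k <= n by apply: leq_trunc_div.
have qn' : n < (n %/ k).+1 * k by apply: ltn_ceil.
have s1 : s * 3 <= n - n %/ k - c.+1 by apply: leq_trunc_div.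
have s2 : n - n %/ k - c.+1 < s.+1 * 3 by apply: ltn_ceil.
have sn : s * 3 <= n by apply: leq_trans s1 _; rewrite -subnDA leq_subr.
have qn1 := leq_div n k; move: s (n %/ k) s1 s2 cn qn qn' qn1 sn.
move=> s q s1 s2 cn qn qn' qn1 sn.
have le_gs : s <= g_K3_S4 n.
  have leMn : 3 * (D + 2) + 1 <= n.
    by apply: leq_trans qn1; apply: leq_trans cn; rewrite /c; clear; lia.
  have [F [R [SC cF cR]]] := stock_start leMn.
  apply: leq_trans (stock_value (D := D) (s := s) SC _ _ _); first exact: leq_addl.
  - by rewrite cR addn1.
  - have -> : #|F| - 3 * s - (2 * D + 4) = n - c - s * 3.
      by rewrite cF /c; clear; lia.
    rewrite cards0 add0n; have [s0|s0] := posnP s.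
      by rewrite s0 muln_gt0 subn_gt0 /=; move: qn1 cn; clear; lia.
    have : q < n - c - s * 3 by move: s0 s1; clear; lia.
    move/(leq_mul (leqnn (8 * k)%N)) => X; apply: leq_trans (_ : 8 * n < _).
      by move: sn; clear; lia.
    by move: X qn'; rewrite /D; clear; nia.
  (* The fuel suffices because [8 * s <= 8 * n], and [n - 1] is at least 16. *)
  rewrite bin2; apply: leq_trans (_ : (16 * n)./2 <= _).
    by move: sn; clear; lia.
  apply: half_leq; rewrite mulnC leq_mul2l; apply/orP; right.
  by move: nk k0; clear; nia.
(* With [q] for [n %/ k], rounding gives [3 * s >= n - q - (c + 3) >= n - 2 * q]; multiply by [k]
   and use [q * k <= n]. *)
by move: le_gs s2 cn qn; clear; nia.
Qed.

End Construct.

Import Order.TTheory GRing.Theory Num.Theory.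
Local Open Scope ring_scope.

(* g(n,K_3,S_4) = (1 + o(1)) n/3 as n -> oo *)
Theorem theorem1p3 :
  forall eps : rat, 0 < eps ->
  exists N : nat, forall n : nat, (N <= n)%N ->
    `| (g_K3_S4 n)%:R - (n%:R / 3 : rat) | <= eps * (n%:R / 3).
Proof.
(* As [k >= 2 / eps], the loss [2 * n / k] in the lower bound for [3 * g] is at most [eps * n]. *)
move=> eps eps0; pose k := (Num.bound (2 / eps)).+1.
exists (k * (40 * k + 20))%N => n nk.
have up : (3 * g_K3_S4 n <= n)%N by rewrite mulnC -leq_divRL // g_K3_S4_leq.
have lo : (k * n <= 3 * (k * g_K3_S4 n) + 2 * n)%N by apply: g_K3_S4_geq.
have ek : 2 <= eps * k%:R.
  rewrite mulrC -ler_pdivrMr //; apply/ltW.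
  have := archi_boundP (ltW (divr_gt0 (ltr0n _ 2) eps0)).
  move/lt_le_trans; apply; by rewrite ler_nat leqnSn.
move: up lo; rewrite -!(ler_nat rat) !(natrM, natrD).
set g : rat := (g_K3_S4 n)%:R; set m : rat := n%:R => up lo.
have m0 : 0 <= m := ler0n _ n.
have k0 : 0 < k%:R :> rat by rewrite ltr0n.
have em := ler_wpM2r m0 ek.
have {em} : k%:R * (m - 3 * g) <= k%:R * (eps * m) by lra.
rewrite ler_pM2l // => lo'.
have e0 : 0 <= eps * m by rewrite mulr_ge0 // ltW.
by rewrite ler_norml; apply/andP; split; lra.
Qed.
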